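(* For a locally compact group $G$ and $p\ge 1$, consider the following statements: (1) $G$ has property $BP_{L^p}$. (2) Every action of $G$ on a space with measured walls $X$ is either bounded or proper (when $X$ is endowed with the wall distance). Then (1) implies (2). The converse holds if $1\le p\le 2$ and $G$ is separable.
   Context: A wall on a set $X$ is a partition of $X$ into two classes. A space with measured walls is a 4-tuple $(X,\mathcal{W},\mathcal{B},\mu)$ where $\mathcal{W}$ is a set of walls on $X$, $\mathcal{B}$ is a $\sigma$-algebra of subsets of $\mathcal{W}$ and $\mu$ is a measure on $\mathcal{B}$ such that, for any $x,y\in X$, the set $\mathcal{W}(x|y)$ of walls separating $x$ from $y$ belongs to $\mathcal{B}$ and has finite measure. The wall distance is the pseudo-metric $(x,y)\mapsto\mu(\mathcal{W}(x|y))$ on $X$. An action of $G$ on a space with measured walls is an action on $X$ by automorphisms of the structure $(X,\mathcal{W},\mathcal{B},\mu)$; in particular it preserves the wall distance. An isometric action of $G$ on a (pseudo-)metric space $(X,\delta)$ is bounded if every orbit is bounded, and proper if $\delta(gx,x)\to\infty$ as $g\to\infty$ in $G$, for every $x\in X$. $G$ has property $BP_{L^p}$ if every continuous affine isometric action of $G$ on an $L^p$-space $L^p(\Omega,\nu)$ is either bounded or proper.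
   Formalization: Actions of G on a space with measured walls are required to be continuous for the wall distance; without this (1) ⇒ (2) fails, e.g. p=2, SL_3(R)×S^1 acting on the line by translations through a nonzero discontinuous homomorphism S^1→R. *)

(* Defs.v *)
From HB Require Import structures.
From mathcomp Require Import all_boot all_order all_algebra.
From mathcomp Require Import all_classical all_reals all_analysis.

Set Implicit Arguments.
Unset Strict Implicit.
Unset Printing Implicit Defensive.

Import Order.TTheory GRing.Theory Num.Theory.
Import numFieldNormedType.Exports.

Local Open Scope classical_set_scope.
Local Open Scope ring_scope.

HB.mixin Record Topological_isTopologicalGroup G of Topological G & Group G := {
  mulg_continuous : continuous (fun x : G * G => (x.1 * x.2)%g) ;
  invg_continuous : continuous (fun x : G => (x^-1)%g)
}.

#[short(type="topologicalGroupType")]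
HB.structure Definition TopologicalGroup :=
  {G of Topological G & Group G & Topological_isTopologicalGroup G}.

Definition separable_space (T : topologicalType) :=
  exists2 S : set T, countable S & dense S.

Definition at_infinity (T : topologicalType) : set_system T :=
  [set A | exists2 K, compact K & ~` K `<=` A].
Arguments at_infinity T : clear implicits.

#[global] Instance at_infinity_filter (T : topologicalType) :
  Filter (at_infinity T).
Proof.
split=> [|A B [K cK KA] [L cL LB]|A B AB [K cK KA]].
- by exists set0; [exact: compact0|].
- exists (K `|` L); first exact: compactU.
  by rewrite setCU; exact: setISS.
- by exists K => //; exact: subset_trans AB.
Qed.

Section Actions.
Context (R : realType) (G : topologicalGroupType) (X : Type).
Implicit Types (act : G -> X -> X) (d : X -> X -> R).

Definition group_action act :=
  (forall x, act 1%g x = x) /\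
  (forall g h x, act (g * h)%g x = act g (act h x)).

Definition isometric_action d act :=
  forall g x y, d (act g x) (act g y) = d x y.

(* Joint continuity of [G * X -> X], where [X] carries the topology of the
   pseudo-metric [d]. *)
Definition continuous_action d act :=
  forall g x (e : R), 0 < e -> exists2 r : R, 0 < r &
    \forall h \near g, forall y, d x y < r -> d (act g x) (act h y) < e.

Definition bounded_action d act :=
  forall x, exists M : R, forall g h, d (act g x) (act h x) <= M.

Definition proper_action d act :=
  forall x, (fun g => d (act g x) x) @ at_infinity G --> +oo.

End Actions.

Section MeasuredWalls.
Context (R : realType) (X : Type).

Definition is_wall (w : set (set X)) :=
  exists A : set X, [/\ A !=set0, ~` A !=set0 & w = [set A; ~` A]].

Definition separates (w : set (set X)) (x y : X) :=
  exists2 A, w A & A x /\ ~ A y.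

Definition walls_between (W : set (set (set X))) (x y : X) :=
  [set w | W w /\ separates w x y].

(* The sigma-algebra [wall_algebra] lives on the subset [walls] of the type
   [set (set X)], whereas library measures are defined on sigma-algebras on a
   whole type. A measure on [wall_algebra] is therefore represented by its
   extension by zero to the sigma-algebra generated on [set (set X)].
   The library's [sigma_algebra W B] does not force the members of [B] to be
   subsets of [W]. *)
Record measured_walls := MeasuredWalls {
  walls : set (set (set X)) ;
  wall_algebra : set (set (set (set X))) ;
  wall_measure :
    {measure set (g_sigma_algebraType wall_algebra) -> \bar R} ;
  walls_are_walls : forall w, walls w -> is_wall w ;
  wall_algebra_sub : forall A, wall_algebra A -> A `<=` walls ;
  wall_algebra_sigma : sigma_algebra walls wall_algebra ;
  wall_measure_setC : wall_measure (~` walls) = 0%E ;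
  walls_between_in : forall x y, wall_algebra (walls_between walls x y) ;
  walls_between_fin : forall x y,
    (wall_measure (walls_between walls x y) < +oo)%E
}.

Definition wall_dist (S : measured_walls) (x y : X) : R :=
  fine (wall_measure S (walls_between (walls S) x y)).

Definition wall_map (s : X -> X) (w : set (set X)) : set (set X) :=
  [set s @` A | A in w].

Definition wall_automorphism (S : measured_walls) (s : X -> X) :=
  [/\ bijective s,
      forall w, walls S (wall_map s w) <-> walls S w,
      forall A, wall_algebra S (wall_map s @` A) <-> wall_algebra S A &
      forall A, wall_algebra S A ->
        wall_measure S (wall_map s @` A) = wall_measure S A].

Lemma wall_automorphism_dist (S : measured_walls) s :
  wall_automorphism S s -> forall x y, wall_dist S (s x) (s y) = wall_dist S x y.
Proof.
move=> [bs Ws _ mus] x y; rewrite /wall_dist; congr fine.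
rewrite -[RHS]mus; last exact: walls_between_in.
have [s' sK s'K] := bs.
have imK A : s @` (s' @` A) = A.
  by rewrite image_comp (_ : s \o s' = id) ?image_id//; apply/funext.
have wK w : wall_map s (wall_map s' w) = w.
  apply/seteqP; split=> [_ [_ [B wB <-] <-]|B wB]; rewrite ?imK//.
  by exists (s' @` B); [exists B|exact: imK].
congr (wall_measure S _); apply/seteqP; split.
  move=> w [Ww [A wA [Ax Ay]]].
  exists (wall_map s' w); last exact: wK.
  split; first by apply/Ws; rewrite wK.
  exists (s' @` A); first by exists A.
  split; first by exists (s x); rewrite ?sK.
  by move=> [z Az zy]; apply: Ay; rewrite -zy s'K.
move=> _ [w [Ww [A wA [Ax Ay]]] <-]; split; first by apply/Ws.
exists (s @` A); first by exists A.
split; first by exists x.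
by move=> [z Az /(can_inj sK) zy]; apply: Ay; rewrite -zy.
Qed.

End MeasuredWalls.

(* Actions of a topological group are understood to be continuous, here with
   respect to the wall distance; for a discrete group this condition is void.
   Without it, the implication from [BP_Lp] fails: a discontinuous embedding of
   SL_2(R) into SL_2(C) gives an action on hyperbolic 3-space that is neither
   bounded nor proper. *)
Definition walls_bounded_or_proper (R : realType) (G : topologicalGroupType) :=
  forall (X : Type) (S : measured_walls R X) (act : G -> X -> X),
    group_action act ->
    (forall g, wall_automorphism S (act g)) ->
    continuous_action (wall_dist S) act ->
    bounded_action (wall_dist S) act \/ proper_action (wall_dist S) act.

Section LpActions.
Context (R : realType) (d : measure_display) (T : measurableType d).
Context (nu : {measure set T -> \bar R}) (p : R) (p1 : (1 <= p%:E)%E).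
Local Notation Lp := (LspaceType nu p1).

Definition Lp_dist (u v : Lp) : R :=
  fine 'N[nu]_(p%:E)[EFin \o ((u : T -> R) \- (v : T -> R))].

(* The library has no vector space structure on [LspaceType]; the affine
   combination [w = (1 - t) u + t v] is expressed on representatives. *)
Definition Lp_affine (f : Lp -> Lp) :=
  forall (t : R) (u v w : Lp),
    {ae nu, forall x, (w x : R) = (1 - t) * (u x : R) + t * (v x : R)} ->
    {ae nu, forall x,
      (f w x : R) = (1 - t) * (f u x : R) + t * (f v x : R)}.

End LpActions.

Definition BP_Lp (R : realType) (G : topologicalGroupType) (p : R)
    (p1 : (1 <= p%:E)%E) :=
  forall (d : measure_display) (T : measurableType d)
    (nu : {measure set T -> \bar R})
    (act : G -> LspaceType nu p1 -> LspaceType nu p1),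
    group_action act ->
    (forall g, Lp_affine (act g)) ->
    isometric_action (@Lp_dist _ _ _ nu p p1) act ->
    continuous_action (@Lp_dist _ _ _ nu p p1) act ->
    bounded_action (@Lp_dist _ _ _ nu p p1) act \/
    proper_action (@Lp_dist _ _ _ nu p p1) act.

(* Main.v *)
(* From walls to L^p.  Fix a base point x0.  On functions on the set of walls let g send f to
   f o g^-1, replaced by 1 - f o g^-1 on the walls separating x0 from g x0.  This is an affine
   isometric action on L^p; it moves 0 to the indicator of W(x0|g x0), whose L^p norm to the
   power p is the wall distance from x0 to g x0.  To make the action continuous, the
   sigma-algebra and the measure are first replaced by the part on which mu(A \ gA) -> 0 as
   g -> 1, which contains all the sets W(x|y).

   From L^p to walls (p <= 2).  The kernel psi(g, h) = |g v - h v|^p on G is left invariant and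
   conditionally of negative type, so it is the variogram of a Gaussian process Z, up to a
   factor.  Toss n coins at each point x, showing heads with probability sin^2((U + Z_x)/2) where
   U is a uniform phase, and cut the space at a random level of the number of heads.  In the
   limit n -> oo this is an invariant finitely additive probability on the subsets of G, giving
   the sets that separate x from y a mass between (1 - exp(-2 psi))/4 and its square root.
   Subsets of G form a compact space, so on walls this content is sigma-additive on clopen sets,
   also after summation over the rescaled kernels psi/4^k, k >= 0.  The resulting wall distance
   is at most a multiple of sqrt psi and tends to infinity with psi. *)
Require Import Defs.
From HB Require Import structures.
From mathcomp Require Import all_boot all_order all_algebra.
From mathcomp Require Import all_classical all_reals all_analysis measurable_realfun.
From mathcomp Require Import ring lra finmap.
Set Implicit Arguments.
Unset Strict Implicit.
Unset Printing Implicit Defensive.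
Import Order.TTheory GRing.Theory Num.Theory.
Import numFieldNormedType.Exports.
Local Open Scope classical_set_scope.
Local Open Scope ring_scope.

(** * Powers of the distance on the line *)

Section ScalarNegativeType.
Context {R : realType}.

(** The coin model is used because its finite-dimensional laws are explicit functions of [psi]
    alone: every bijection that preserves [psi] preserves them exactly, without a base point and
    without a Gaussian measure on an infinite product. The uniform phase makes this possible: [psi]
    is only conditionally negative, so the field is determined only up to an additive constant, and
    averaging over that constant leaves nothing but increments. One coin per point would not do: two
    distinct points would be separated with probability at least 1/4 even where [psi] vanishes, and
    the distance would not be continuous. With n coins this noise adds only 1/(4n) to the second
    moment. A single scale gives a bounded distance, whence the sum over k: its k-th term decays
    like 2^-k sqrt psi, but is at least 1/8 as soon as psi >= 4^k, so the sum is finite and grows at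
    least logarithmically. *)

Lemma continuous_normr_powR (a : R) : 0 < a -> continuous (fun t : R => `|t| `^ a).
Proof.
move=> a0 t; have [->|t0] := eqVneq t 0.
  apply/cvgrPdist_lt => e e0; near=> s.
  rewrite normr0 powR0 ?gt_eqF// sub0r normrN ger0_norm ?powR_ge0//.
  have -> : e = (e `^ a^-1) `^ a by rewrite -powRrM mulVf ?gt_eqF// powRr1// ltW.
  apply: gt0_ltr_powR => //; rewrite ?nnegrE ?powR_ge0//.
  near: s; have ea : 0 < e `^ a^-1 by rewrite powR_gt0.
  have := @cvgr0_norm_lt _ _ _ _ (nbhs_filter (0:R)) (fun x : R => x) cvg_id _ ea.
  exact.
have t1 : 0 < `|t| by rewrite normr_gt0.
have : {for `|t|, continuous (powR (R:=R) ^~ a)}.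
  apply: differentiable_continuous; apply/derivable1_diffP.
  by have [] := is_derive1_powR a t1.
move=> H; apply: (@continuous_comp _ _ _ (fun t : R => `|t|) (powR (R:=R) ^~ a)) H.
exact: norm_continuous.
Unshelve. all: by end_near. Qed.

(** The coefficient of z^(n+1) in 1 - (1 - z)^a. For 0 <= a <= 1 it is nonnegative, which is what
    will turn positive kernels into a kernel of negative type. *)
Fixpoint binom_coef (a : R) (n : nat) : R :=
  if n is m.+1 then binom_coef a m * (m.+1%:R - a) / m.+2%:R else a.

Lemma binom_coef_ge0 a n : 0 <= a <= 1 -> 0 <= binom_coef a n.
Proof.
move=> /andP[a0 a1]; elim: n => [//|n IH] /=.
rewrite divr_ge0// mulr_ge0// subr_ge0 (le_trans a1)// ler1n//.
Qed.

Lemma binom_coef_le a n : 0 <= a <= 1 -> n.+1%:R * binom_coef a n <= a.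
Proof.
move=> /[dup] ha /andP[a0 a1]; elim: n => [|n IH] /=; first by rewrite mul1r.
apply: le_trans IH; rewrite mulrC divfK ?pnatr_eq0// [leRHS]mulrC.
by rewrite ler_wpM2l ?binom_coef_ge0// gerBl.
Qed.

Definition binom_poly (a : R) (n : nat) (z : R) : R :=
  1 - \sum_(i < n) binom_coef a i * z ^+ i.+1.

Definition binom_polyD (a : R) (n : nat) (z : R) : R :=
  - \sum_(i < n) binom_coef a i * (i.+1%:R * z ^+ i).

Lemma is_derive_binom_poly a n (z : R) :
  is_derive z 1 (binom_poly a n) (binom_polyD a n z).
Proof.
elim: n => [|n IH].
  rewrite /binom_poly /binom_polyD big_ord0 oppr0.
  rewrite (_ : (fun _ => _) = cst 1); first exact: is_derive_cst.
  by apply/funext => x; rewrite big_ord0 subr0.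
rewrite (_ : binom_poly a n.+1 =
    binom_poly a n - binom_coef a n *: (id ^+ n.+1)); last first.
  apply/funext => x; rewrite /binom_poly/= big_ord_recr opprD addrA.
  by rewrite !fctE.
rewrite (_ : binom_polyD a n.+1 z =
    binom_polyD a n z - binom_coef a n *: (n.+1%:R *: z ^+ n *: 1)); last first.
  by rewrite /binom_polyD big_ord_recr/= opprD /GRing.scale/= mulr1.
apply: is_deriveB.
Qed.

(** The function (1 - z)^a solves (1 - z) y' + a y = 0; its Taylor polynomial misses this equation
    by a single monomial. *)
Lemma binom_poly_ode a n z :
  (1 - z) * binom_polyD a n z + a * binom_poly a n z
    = n.+1%:R * binom_coef a n * z ^+ n.
Proof.
elim: n => [|n IH].
  by rewrite /binom_polyD /binom_poly !big_ord0 /= oppr0 mulr0 addr0 expr0 !mulr1 mul1r add0r.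
rewrite /binom_polyD /binom_poly !big_ord_recr/= -/(binom_coef a n).
rewrite !opprD; move: IH; rewrite /binom_polyD /binom_poly.
set s1 := (\sum_(i < n) _); set s2 := (\sum_(i < n) _) => IH.
rewrite mulrDr addrA [a * _]mulrDr addrACA IH.
have -> : n.+2%:R * (binom_coef a n * (n.+1%:R - a) / n.+2%:R)
    = binom_coef a n * (n.+1%:R - a) by rewrite mulrC divfK ?pnatr_eq0.
rewrite exprS; ring.
Qed.

Lemma binom_poly_cvg a z : 0 < a <= 1 -> 0 <= z < 1 ->
  binom_poly a n z @[n --> \oo] --> (1 - z) `^ a.
Proof.
move=> /andP[a0 a1] /andP[z0 z1]; have z10 : 0 < 1 - z by rewrite subr_gt0.
have ha : 0 <= a <= 1 by rewrite (ltW a0).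
pose K := a * (1 - z) `^ (- a - 1) * (1 - z) `^ a.
suff H n : `|(1 - z) `^ a - binom_poly a n z| <= K * z ^+ n.
  apply/cvgrPdist_le => e e0.
  have : (K * z ^+ n) @[n --> \oo] --> (K * 0 : R).
    by apply: cvgMr; apply: cvg_expr; rewrite ger0_norm.
  rewrite mulr0 => /cvgr0_norm_le /(_ _ e0); apply: filterS => n.
  by apply: le_trans; apply: le_trans (H n) _; exact: ler_norm.
(* [h] is the polynomial divided by its expected limit. By the differential equation its derivative
   is the single term [dh], so the mean value theorem bounds the error. *)
pose h (x : R) := binom_poly a n x * (1 - x) `^ (- a).
pose dh (x : R) := n.+1%:R * binom_coef a n * x ^+ n * (1 - x) `^ (- a - 1).
have dhP (x : R) : x < 1 -> is_derive x 1 h (dh x).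
  move=> x1; have x10 : 0 < 1 - x by rewrite subr_gt0.
  have D1 : is_derive x 1 (fun x : R => 1 - x) (0 - 1) by apply: is_deriveB.
  have D2 := is_derive1_powR (- a) x10.
  have D3 := @is_derive1_comp R (powR (R:=R) ^~ (- a)) (fun x => 1 - x) x _ _ D2 D1.
  have D4 := is_deriveM (is_derive_binom_poly a n x) D3.
  apply: (is_derive_eq D4).
  rewrite /dh /= -binom_poly_ode /GRing.scale/=.
  have -> : (1 - x) `^ (- a) = (1 - x) `^ (- a - 1) * (1 - x).
    by rewrite -{1}(subrK 1 (- a)) powRD ?powRr1 ?ltW//; apply/implyP => _; rewrite gt_eqF.
  ring.
have [c /[!in_itv]/= /andP[c0 cz] hE] :
    exists2 c, c \in `[0, z] & h z - h 0 = dh c * (z - 0).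
  apply: MVT_segment => //.
    by move=> x; rewrite in_itv/= => /andP[_ xz]; apply: dhP; exact: lt_trans z1.
  apply: derivable_within_continuous => x; rewrite in_itv/= => /andP[_ xz].
  by have [] := dhP x (le_lt_trans xz z1).
have h0 : h 0 = 1.
  rewrite /h subr0 powR1 mulr1 /binom_poly big1 ?subr0// => i _.
  by rewrite expr0n mulr0.
have -> : (1 - z) `^ a - binom_poly a n z = - (h z - h 0) * (1 - z) `^ a.
  have E : (1 - z) `^ (- a) * (1 - z) `^ a = 1.
    by rewrite -powRD ?addNr ?powRr0//; apply/implyP => _; rewrite gt_eqF.
  by rewrite h0 [- (h z - 1)]opprB mulrBl mul1r; congr (_ - _); rewrite -[RHS]mulrA E mulr1.
rewrite normrM normrN (ger0_norm (powR_ge0 _ _)) /K -mulrAC.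
rewrite ler_wpM2r ?powR_ge0// hE subr0.
have c1 : c < 1 by exact: le_lt_trans z1.
have dc0 : 0 <= dh c by rewrite /dh !mulr_ge0// ?powR_ge0 ?binom_coef_ge0// exprn_ge0.
rewrite ger0_norm; last by apply: mulr_ge0.
apply: (@le_trans _ _ (dh c)); first by rewrite ler_piMr// ltW.
have pw0 (x : R) : 0 <= x `^ (- a - 1) by exact: powR_ge0.
rewrite /dh [leRHS]mulrAC; apply: ler_pM => //.
- by rewrite !mulr_ge0// ?binom_coef_ge0// exprn_ge0.
- apply: ler_pM.
  + by rewrite mulr_ge0// binom_coef_ge0.
  + by rewrite exprn_ge0.
  + exact: binom_coef_le.
  + by rewrite lerXn2r ?nnegrE.
have E (x : R) : x `^ (- a - 1) = (x `^ (a + 1))^-1 by rewrite -opprD powRN.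
have c10 : 0 < 1 - c by rewrite subr_gt0.
rewrite !E lef_pV2 ?posrE ?powR_gt0//; apply: ge0_ler_powR.
- by rewrite addr_ge0// ltW.
- by rewrite nnegrE ltW.
- by rewrite nnegrE ltW.
- by rewrite lerD2l lerN2.
Qed.

Lemma cvg_sumr (T : Type) (F : set_system T) (I : Type) (r : seq I) (P : pred I)
    (f : I -> T -> R) (l : I -> R) : Filter F ->
  (forall i, P i -> f i x @[x --> F] --> l i) ->
  \sum_(i <- r | P i) f i x @[x --> F] --> \sum_(i <- r | P i) l i.
Proof.
move=> FF fl; elim: r => [|i r IH].
  by rewrite big_nil; under eq_fun do rewrite big_nil; exact: cvg_cst.
rewrite big_cons; under eq_fun do rewrite big_cons.
by case: ifPn => // Pi; apply: cvgD => //; exact: fl.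
Qed.

(** The kernel cos (x - y) = cos x cos y + sin x sin y is a sum of two rank-one kernels, so each
    factor splits the form into two forms of lower degree. *)
Lemma cos_kernel_ge0 (I : finType) (c a : I -> R) n :
  0 <= \sum_i \sum_j c i * c j * cos (a i - a j) ^+ n.
Proof.
elim: n c => [|n IH] c.
  rewrite (_ : \sum_i _ = (\sum_i c i) ^+ 2) ?sqr_ge0//.
  rewrite expr2 mulr_suml; apply: eq_bigr => i _; rewrite mulr_sumr.
  by apply: eq_bigr => j _; rewrite mulr1.
rewrite (_ : \sum_i _ =
    (\sum_i \sum_j (c i * cos (a i)) * (c j * cos (a j)) * cos (a i - a j) ^+ n) +
    (\sum_i \sum_j (c i * sin (a i)) * (c j * sin (a j)) * cos (a i - a j) ^+ n)).
  by rewrite addr_ge0.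
rewrite -big_split; apply: eq_bigr => i _; rewrite -big_split; apply: eq_bigr => j _.
rewrite exprS {1}cosB /=; ring.
Qed.

(** The power expands as 1 minus a series with nonnegative coefficients in the positive kernels
    cos^k, and the constant 1 drops out since the [c i] sum to 0. The factor [r] keeps the argument
    of the series below 1. *)
Lemma cos_powR_negative_type (I : finType) (c a : I -> R) (r al : R) :
  0 < al <= 1 -> 0 <= r < 1 -> \sum_i c i = 0 ->
  (forall i j, 0 <= cos (a i - a j)) ->
  \sum_i \sum_j c i * c j * (1 - r * cos (a i - a j)) `^ al <= 0.
Proof.
move=> hal /andP[r0 r1] c0 cosp.
have alh : 0 <= al <= 1 by case/andP: hal => h ->; rewrite ltW.
have H : \sum_i \sum_j c i * c j * binom_poly al n (r * cos (a i - a j)) @[n --> \oo]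
   --> \sum_i \sum_j c i * c j * (1 - r * cos (a i - a j)) `^ al.
  apply: cvg_sumr => i _; apply: cvg_sumr => j _; apply: cvgMr.
  apply: binom_poly_cvg => //; rewrite mulr_ge0//=.
  by rewrite (le_lt_trans _ r1)// ler_piMr// cos_le1.
apply: cvgr_to_le H _; apply: nearW => n.
rewrite (_ : \sum_i _ = - \sum_(k < n) binom_coef al k * r ^+ k.+1 *
    \sum_i \sum_j c i * c j * cos (a i - a j) ^+ k.+1).
  rewrite oppr_le0 sumr_ge0// => k _; rewrite mulr_ge0 ?cos_kernel_ge0//.
  by rewrite mulr_ge0 ?binom_coef_ge0// exprn_ge0.
under eq_bigr do under eq_bigr do rewrite mulrBr mulr1.
under eq_bigr do rewrite sumrB -mulr_sumr c0 mulr0 sub0r.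
rewrite sumrN; congr (- _); rewrite [RHS](eq_bigr (fun k : 'I_n => \sum_i \sum_j
   (binom_coef al k * r ^+ k.+1) * (c i * c j * cos (a i - a j) ^+ k.+1))); last first.
  by move=> k _; rewrite mulr_sumr; apply: eq_bigr => i _; rewrite mulr_sumr.
rewrite [RHS]exchange_big; apply: eq_bigr => i _.
rewrite [RHS]exchange_big; apply: eq_bigr => j _; rewrite mulr_sumr.
apply: eq_bigr => k _; rewrite exprMn; ring.
Qed.

(** With m = n + 1, the damping 1 - m^-3 is strictly below 1, as the binomial series requires, yet
    after rescaling it costs only m^2 m^-3 = 1/m, so the quadratic limit survives. *)
Lemma cvg_scaled_1Bcos (x : R) :
  n.+1%:R ^+ 2 * (1 - (1 - n.+1%:R^-1 ^+ 3) * cos (x / n.+1%:R)) @[n --> \oo]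
    --> x ^+ 2 / 2.
Proof.
have n0 (n : nat) : n.+1%:R != 0 :> R by rewrite pnatr_eq0.
have E (m : R) : m != 0 -> m ^+ 2 * (1 - (1 - m^-1 ^+ 3) * cos (x / m)) =
   2 * (m * sin (x / 2 / m)) ^+ 2 + m^-1 * cos (x / m).
  move=> m0; rewrite (_ : x / m = (x / 2 / m) *+ 2); last by field.
  rewrite cos_mulr2n; set s := x / 2 / m; have := cos2Dsin2 s.
  by move=> /(canRL (addrK _)) ->; field.
under eq_fun do rewrite E//.
have -> : x ^+ 2 / 2 = 2 * (x / 2) ^+ 2 + 0 :> R by field.
have inv0 : (n.+1%:R^-1 : R) @[n --> \oo] --> (0 : R) by exact: cvg_harmonic.
apply: cvgD; last first.
  apply/cvgrPdist_le => e e0; move/cvgrPdist_le : inv0 => /(_ e e0).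
  apply: filterS => n; rewrite !sub0r !normrN normrM; apply: le_trans.
  by rewrite ler_piMr// ler_norml cos_geN1 cos_le1.
apply: cvgMr; rewrite !expr2; suff H : n.+1%:R * sin (x / 2 / n.+1%:R) @[n --> \oo] --> x / 2.
  by rewrite [fun _ => _](_ : _ = fun n => (n.+1%:R * sin (x / 2 / n.+1%:R)) * (n.+1%:R * sin (x
    / 2 / n.+1%:R))); [exact: cvgM | by apply/funext => n; rewrite expr2].
have [y0|y0] := eqVneq (x / 2) 0.
  rewrite y0; under eq_fun do rewrite mul0r sin0 mulr0; exact: cvg_cst.
have := is_derive_sin (0 : R) => -[dS eS].
have : (sin h / h) @[h --> (0 : R)^'] --> (1 : R).
  move: dS => /cvg_ex[l Hl]; have := cvg_lim (@Rhausdorff R) Hl.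
  move: eS; rewrite /derive => -> ; rewrite cos0 => l1; rewrite l1.
  apply: cvg_trans Hl; apply: near_eq_cvg; near=> h.
  by rewrite /= addr0 sin0 subr0 /GRing.scale/= mulr1 mulrC.
move=> H.
have yn : (x / 2 / n.+1%:R) @[n --> \oo] --> (0 : R).
  by rewrite -(mulr0 (x / 2)); apply: cvgMr.
move/cvgr_dnbhsP : H => /(_ _ (conj (fun n => mulf_neq0 y0 (invr_neq0 (n0 n))) yn)) H1.
rewrite -[x in _ --> x](mulr1 (x / 2)).
rewrite (_ : (fun _ => _) = (fun n => x / 2 * (sin (x / 2 / n.+1%:R) / (x / 2 / n.+1%:R)))).
  exact: cvgMr.
apply/funext => n; move: y0; rewrite mulf_eq0 negb_or => /andP[x0 _].
by move: (n.+1%:R) (n0 n) => m m0; field; rewrite ?x0 ?m0.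
Unshelve. all: by end_near. Qed.

(** Up to the constant 2^(p/2), |x|^p is the limit of the powers of exponent [al] = p/2 of the
    functions of [cvg_scaled_1Bcos]; the bound p <= 2 is exactly [al] <= 1. The cosines are
    eventually nonnegative because there are finitely many points. *)
Theorem powR_dist_negative_type (I : finType) (c a : I -> R) (p : R) :
  0 < p <= 2 -> \sum_i c i = 0 ->
  \sum_i \sum_j c i * c j * `|a i - a j| `^ p <= 0.
Proof.
move=> /andP[p0 p2] c0; pose al := p / 2.
have hal : 0 < al <= 1 by rewrite divr_gt0//= ler_pdivrMr// mul1r.
pose t n (x : R) := n.+1%:R ^+ 2 * (1 - (1 - n.+1%:R^-1 ^+ 3) * cos (x / n.+1%:R)).
have H : \sum_i \sum_j c i * c j * `|t n (a i - a j)| `^ al @[n --> \oo]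
   --> \sum_i \sum_j c i * c j * `|(a i - a j) ^+ 2 / 2| `^ al.
  apply: cvg_sumr => i _; apply: cvg_sumr => j _; apply: cvgMr.
  have al0 : 0 < al by case/andP: hal.
  exact: (cvg_comp (t ^~ (a i - a j)) _ (@cvg_scaled_1Bcos (a i - a j))
    (@continuous_normr_powR al al0 ((a i - a j) ^+ 2 / 2))).
have : \sum_i \sum_j c i * c j * `|(a i - a j) ^+ 2 / 2| `^ al <= 0.
  apply: cvgr_to_le H _.
  have : \forall n \near \oo, forall i j, 0 <= cos ((a i - a j) / n.+1%:R).
    apply: filter_forall => i; apply: filter_forall => j.
    have : cos ((a i - a j) / n.+1%:R) @[n --> \oo] --> cos (0 : R).
      have H1 : (a i - a j) / n.+1%:R @[n --> \oo] --> (0 : R).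
        by rewrite -(mulr0 (a i - a j)); apply: cvgMr; exact: cvg_harmonic.
      exact: (cvg_comp (fun n => (a i - a j) / n.+1%:R) _ H1 (@continuous_cos R 0)).
    by rewrite cos0 => /cvgr_ge; apply.
  apply: filterS => n cosp.
  have r01 : 0 <= 1 - (n.+1%:R : R)^-1 ^+ 3 < 1.
    have n1 : 0 < (n.+1%:R^-1 : R) by rewrite invr_gt0.
    rewrite subr_ge0 gtrBl exprn_gt0// andbT.
    by apply: exprn_ile1; [exact: ltW | rewrite invf_le1// ler1n].
  have s0 i j : 0 <= 1 - (1 - n.+1%:R^-1 ^+ 3) * cos ((a i - a j) / n.+1%:R).
    by rewrite subr_ge0 mulr_ile1 ?cos_le1//; case/andP: r01 => // _ /ltW.
  rewrite (_ : \sum_i _ = (n.+1%:R ^+ 2) `^ al * \sum_i \sum_j c i * c j *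
     (1 - (1 - n.+1%:R^-1 ^+ 3) * cos (a i / n.+1%:R - a j / n.+1%:R)) `^ al).
    rewrite mulr_ge0_le0 ?powR_ge0//; apply: cos_powR_negative_type => //.
    by move=> i j; rewrite -mulrBl.
  rewrite mulr_sumr; apply: eq_bigr => i _; rewrite mulr_sumr; apply: eq_bigr => j _.
  rewrite [RHS]mulrCA -mulrBl -powRM ?sqr_ge0//; congr (_ * _ `^ _).
  by rewrite ger0_norm// mulr_ge0 ?sqr_ge0.
rewrite (_ : \sum_i _ = 2^-1 `^ al * \sum_i \sum_j c i * c j * `|a i - a j| `^ p).
  by rewrite pmulr_rle0// powR_gt0.
rewrite mulr_sumr; apply: eq_bigr => i _; rewrite mulr_sumr; apply: eq_bigr => j _.
rewrite [RHS]mulrCA normrM powRM// normrX (@ger0_norm _ 2^-1) ?invr_ge0// -powR_mulrn//.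
by rewrite -powRrM [2%:R * _]mulrC divfK// [_ * 2^-1 `^ _]mulrC.
Qed.
End ScalarNegativeType.

(** * Kernels of negative type *)

Section PositiveSemidefiniteKernels.
Context {R : realType}.

Definition kform (I : finType) (K : I -> I -> R) (c d : I -> R) : R :=
  \sum_i \sum_j c i * d j * K i j.

Definition psd (I : finType) (K : I -> I -> R) := forall c, 0 <= kform K c c.

Definition negative_type (I : finType) (K : I -> I -> R) :=
  forall c, \sum_i c i = 0 -> kform K c c <= 0.

Lemma kformDl (I : finType) (K : I -> I -> R) a (c c' d : I -> R) :
  kform K (fun i => a * c i + c' i) d = a * kform K c d + kform K c' d.
Proof.
rewrite /kform mulr_sumr -big_split; apply: eq_bigr => i _.
by rewrite mulr_sumr -big_split; apply: eq_bigr => j _ /=; ring.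
Qed.

Lemma kformC (I : finType) (K : I -> I -> R) (c d : I -> R) :
  (forall i j, K i j = K j i) -> kform K c d = kform K d c.
Proof.
move=> Ks; rewrite /kform exchange_big; apply: eq_bigr => i _.
by apply: eq_bigr => j _; rewrite Ks; ring.
Qed.

Lemma kform_suml (I J : finType) (K : I -> I -> R) (x : J -> R) (a : J -> I -> R) d :
  kform K (fun i => \sum_k x k * a k i) d = \sum_k x k * kform K (a k) d.
Proof.
rewrite /kform; under [RHS]eq_bigr do rewrite mulr_sumr.
rewrite [RHS]exchange_big; apply: eq_bigr => i _.
under [RHS]eq_bigr do rewrite mulr_sumr.
rewrite [RHS]exchange_big; apply: eq_bigr => j _.
by rewrite -mulrA mulr_suml; apply: eq_bigr => k _; ring.
Qed.

Lemma kform_delta (I : finType) (K : I -> I -> R) x d :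
  kform K (fun i => (i == x)%:R) d = \sum_j d j * K x j.
Proof.
rewrite /kform (bigD1 x)//= [X in _ + X]big1 ?addr0; last first.
  by move=> i /negPf ix; apply: big1 => j _; rewrite ix !mul0r.
by apply: eq_bigr => j _; rewrite eqxx mul1r.
Qed.

(* Completing the square at [x]: the minimum over [t] of the form at [c + t delta_x]. *)
Lemma psd_schur (I : finType) (K : I -> I -> R) x c :
  (forall i j, K i j = K j i) -> psd K ->
  (\sum_j c j * K x j) ^+ 2 <= K x x * kform K c c.
Proof.
move=> Ks Kp; set s := \sum_j _; pose e (i : I) : R := (i == x)%:R.
have es : kform K e c = s by exact: kform_delta.
have ee : kform K e e = K x x.
  rewrite kform_delta (bigD1 x)//= big1 ?addr0; first by rewrite /e eqxx mul1r.
  by move=> i /negPf ix; rewrite /e ix mul0r.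
have q t : 0 <= t ^+ 2 * K x x + t * s *+ 2 + kform K c c.
  have := Kp (fun i => t * e i + c i).
  rewrite kformDl kformC// [X in _ + X]kformC// !kformDl ee es (@kformC _ _ c e)// es.
  by move=> H; apply: le_trans H _; rewrite le_eqVlt; apply/orP; left; apply/eqP; ring.
have [Kxx|Kxx] := eqVneq (K x x) 0.
  rewrite Kxx mul0r; have [->|s0] := eqVneq s 0; first by rewrite expr0n.
  have := q (- (kform K c c + 1) / (s *+ 2)).
  have -> : (- (kform K c c + 1) / (s *+ 2)) ^+ 2 * K x x +
    - (kform K c c + 1) / (s *+ 2) * s *+ 2 + kform K c c = -1.
    by rewrite Kxx; field.
  by rewrite oppr_ge0 ler10.
have K0 : 0 < K x x.
  by rewrite lt_def Kxx -ee Kp.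
have := q (- s / K x x).
have -> : (- s / K x x) ^+ 2 * K x x + - s / K x x * s *+ 2 + kform K c c =
  (K x x * kform K c c - s ^+ 2) / K x x by field.
by rewrite pmulr_lge0 ?invr_gt0// subr_ge0.
Qed.

(** Cholesky elimination: points are removed one at a time, [L] is the successive Schur complement,
    and its rows vanish at the points of [l]. *)
Lemma psd_gram (I : finType) (K : I -> I -> R) :
  (forall i j, K i j = K j i) -> psd K ->
  exists s : seq (I -> R), forall i j, K i j = \sum_(v <- s) v i * v j.
Proof.
move=> Ks Kp.
have H (l : seq I) : exists (s : seq (I -> R)) (L : I -> I -> R),
    [/\ forall i j, K i j = \sum_(v <- s) v i * v j + L i j,
        forall i j, L i j = L j i, psd L & forall i j, i \in l -> L i j = 0].
  elim: l => [|x l [s [L [KE Ls Lp L0]]]].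
    by exists [::], K; split => // i j; rewrite big_nil add0r.
  have Lx y : L x x = 0 -> L x y = 0.
    move=> Lxx; have := psd_schur x (fun i => (i == y)%:R) Ls Lp.
    rewrite Lxx mul0r (bigD1 y)//= big1 ?addr0 ?eqxx ?mul1r.
      by move=> h; apply/eqP; rewrite -sqrf_eq0 eq_le h sqr_ge0.
    by move=> i /negPf ->; rewrite mul0r.
  have Lxx0 : 0 <= L x x.
    have := Lp (fun i => (i == x)%:R); rewrite kform_delta (bigD1 x)//= big1.
      by rewrite eqxx mul1r addr0.
    by move=> i /negPf ->; rewrite mul0r.
  (* If the pivot [L x x] is 0, the quotients are 0 since the inverse of 0 is 0: nothing is
     subtracted, and row x is already 0 by [Lx]. *)
  exists ((fun y => L x y / Num.sqrt (L x x)) :: s), (fun i j => L i j - L x i * L x j / L x x).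
  split => [i j|i j|c|i j].
  - rewrite big_cons KE -addrA [RHS]addrCA; congr (_ + _).
    rewrite addrC -[LHS]subr0 -[RHS]addrA; congr (_ + _).
    rewrite mulrACA -invfM -expr2 sqr_sqrtr//; ring.
  - by rewrite Ls; congr (_ - _ / _); rewrite mulrC.
  - have [L0x|L0x] := eqVneq (L x x) 0.
      rewrite (_ : kform _ c c = kform L c c)//; apply: eq_bigr => i _.
      by apply: eq_bigr => j _; rewrite L0x invr0 mulr0 subr0.
    have -> : kform (fun i j => L i j - L x i * L x j / L x x) c c =
        kform L c c - (\sum_j c j * L x j) ^+ 2 / L x x.
      rewrite /kform expr2 !mulr_suml -sumrB; apply: eq_bigr => i _.
      rewrite mulr_sumr mulr_suml -sumrB; apply: eq_bigr => j _; ring.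
    have Lxp : 0 < L x x by rewrite lt_def L0x.
    by rewrite subr_ge0 ler_pdivrMr// mulrC psd_schur.
  - rewrite in_cons => /orP[/eqP ->|il].
      have [L0x|L0x] := eqVneq (L x x) 0; first by rewrite L0x invr0 mulr0 subr0 Lx.
      by rewrite mulrAC mulfV// mul1r subrr.
    by rewrite L0// [L x i]Ls L0// !mul0r subr0.
have [s [L [KE _ _ L0]]] := H (enum I).
by exists s => i j; rewrite KE L0 ?mem_enum// addr0.
Qed.

(** In a Gram decomposition one more factor [K] only rescales the coefficients by each vector, so
    all entrywise powers are positive; the exponential is a limit of their nonnegative
    combinations. *)
Lemma psd_expR (I : finType) (K : I -> I -> R) :
  (forall i j, K i j = K j i) -> psd K -> psd (fun i j => expR (K i j)).
Proof.
move=> Ks Kp; have [s KE] := psd_gram Ks Kp.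
have KX n c : 0 <= kform (fun i j => K i j ^+ n) c c.
  elim: n c => [|n IH] c.
    rewrite (_ : kform _ _ _ = (\sum_i c i) ^+ 2) ?sqr_ge0//.
    rewrite expr2 mulr_suml; apply: eq_bigr => i _; rewrite mulr_sumr.
    by apply: eq_bigr => j _; rewrite mulr1.
  rewrite (_ : kform _ _ _ = \sum_(v <- s) kform (fun i j => K i j ^+ n)
      (fun i => c i * v i) (fun i => c i * v i)); first exact: sumr_ge0.
  rewrite /kform [RHS]exchange_big; apply: eq_bigr => i _.
  rewrite [RHS]exchange_big; apply: eq_bigr => j _.
  rewrite exprS {1}KE mulrCA mulrA mulr_suml mulr_suml; apply: eq_bigr => v _; ring.
move=> c.
have H : kform (fun i j => series (exp_coeff (K i j)) n) c c @[n --> \oo]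
    --> kform (fun i j => expR (K i j)) c c.
  apply: cvg_sumr => i _; apply: cvg_sumr => j _; apply: cvgMr.
  exact: is_cvg_series_exp_coeff.
apply: (cvgr_to_ge H); apply: nearW => n.
rewrite (_ : kform _ _ _ = \sum_(0 <= k < n) (k`!%:R^-1) * kform (fun i j => K i j ^+ k) c c).
  by apply: sumr_ge0 => k _; rewrite mulr_ge0// invr_ge0.
rewrite /kform; under [RHS]eq_bigr do rewrite mulr_sumr.
rewrite [RHS]exchange_big; apply: eq_bigr => i _.
under [RHS]eq_bigr do rewrite mulr_sumr.
rewrite [RHS]exchange_big; apply: eq_bigr => j _.
rewrite /series/= mulr_sumr; apply: eq_bigr => k _; rewrite /exp_coeff/=; ring.
Qed.
End PositiveSemidefiniteKernels.

(** * Coins driven by a negative type kernel *)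

Section Coins.
Context {R : realType}.

Definition bdiff (J : finType) (e e' : {ffun J -> bool}) (j : J) : R :=
  (e j)%:R - (e' j)%:R.

(* [phase_kernel psi e e'] is E exp(i sum_j (e_j - e'_j) eta_j) for eta_j = U + Z_j with U a
   uniform phase and Z Gaussian, E (Z_j - Z_k)^2 = 4 psi j k; hence [coin_prob psi s] below is
   the expectation of the product of the sin^2(eta_j / 2) over [s j] and of the
   cos^2(eta_j / 2) over [~~ s j].  Only the positivity of the kernel is needed, so the
   process itself is never constructed. *)
Definition phase_kernel (J : finType) (psi : J -> J -> R) (e e' : {ffun J -> bool}) : R :=
  (\sum_j e j == \sum_j e' j)%N%:R * expR (kform psi (bdiff e e') (bdiff e e')).

Lemma psd_phase_kernel (J : finType) (psi : J -> J -> R) :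
  (forall i j, psi i j = psi j i) -> negative_type psi -> psd (phase_kernel psi).
Proof.
move=> psiC psin w; pose wt (e : {ffun J -> bool}) := (\sum_j e j)%N.
have wtlt e : (wt e < #|J|.+1)%N.
  rewrite ltnS -sum1_card; apply: leq_sum => j _; exact: leq_b1.
(* The weight condition makes the kernel block diagonal; each block is treated on its own. *)
pose wm m e : R := (wt e == m)%:R * w e.
pose f e e' := expR (kform psi (bdiff e e') (bdiff e e')).
rewrite (_ : kform _ w w = \sum_(m < #|J|.+1) kform f (wm m) (wm m)); last first.
  rewrite /kform [RHS]exchange_big; apply: eq_bigr => e _.
  rewrite [RHS]exchange_big; apply: eq_bigr => e' _ /=.
  rewrite (bigD1 (Ordinal (wtlt e)))//= big1 ?addr0; last first.
    move=> m; rewrite -val_eqE/= eq_sym => /negPf em.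
    by rewrite /wm em !mul0r.
  have -> : phase_kernel psi e e' = (wt e' == wt e)%:R * f e e'.
    by rewrite eq_sym.
  by rewrite /wm eqxx mul1r mulrA; congr (_ * _); rewrite mulrAC -!mulrA; congr (_ * _);
    rewrite mulrC.
apply: sumr_ge0 => m _.
have [[e0 /eqP e0m]|nom] := pselect (exists e, wt e == m); last first.
  rewrite /kform big1// => e _; rewrite big1// => e' _; rewrite /wm.
  by case: eqP => em; rewrite ?mul0r//; case: nom; exists e; rewrite em.
(* Inside a block the differences from a fixed [e0] have zero sum, which makes [B] positive; off the
   block [a] is set to 0. By polarization the exponent is a function of e, plus the same function of
   e', plus [B], and the first two terms are absorbed in the coefficients. *)
pose a e j : R := (wt e == m)%:R * bdiff e e0 j.
pose B e e' := - 2 * kform psi (a e) (a e').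
have Bs e e' : B e e' = B e' e by rewrite /B kformC.
have wtE (e : {ffun J -> bool}) : \sum_j (e j)%:R = (wt e)%:R :> R by rewrite natr_sum.
have Bp : psd B.
  move=> x; pose y j := \sum_e x e * a e j.
  have -> : kform B x x = - 2 * kform psi y y.
    rewrite [in RHS]/y kform_suml mulr_sumr; apply: eq_bigr => e _.
    rewrite kformC// kform_suml !mulr_sumr; apply: eq_bigr => e' _.
    rewrite /B (kformC (a e))//; ring.
  have : kform psi y y <= 0.
    apply: psin; rewrite /y exchange_big big1// => e _.
    rewrite -mulr_sumr -mulr_sumr sumrB !wtE e0m.
    by case: eqP => [->|_]; rewrite ?subrr ?mul0r !mulr0.
  by move=> h; rewrite mulNr oppr_ge0 mulr_ge0_le0.
have := psd_expR Bs Bp (fun e => wm m e * expR (kform psi (a e) (a e))).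
congr (_ <= _); apply: eq_bigr => e _; apply: eq_bigr => e' _.
rewrite /wm; case: eqP => em; last by rewrite !mul0r.
case: eqP => em'; last by rewrite !(mul0r, mulr0).
rewrite !mul1r /f.
have -> : kform psi (bdiff e e') (bdiff e e') =
    kform psi (a e) (a e) + kform psi (a e') (a e') + B e e'.
  have -> : bdiff e e' = (fun j => - 1 * a e' j + a e j).
    by apply/funext => j; rewrite /a em em' eqxx !mul1r mulN1r /bdiff; ring.
  rewrite kformDl kformC// kformDl [X in _ + X]kformC// kformDl /B.
  by rewrite (kformC (a e'))//; ring.
by rewrite !expRD; ring.
Qed.

(** Since sin^2(t/2) = |1 - exp(it)|^2 / 4 and cos^2(t/2) = |1 + exp(it)|^2 / 4, the product over
    all coins is 4^-|J| times the squared modulus of the sum over e of [coin_sign s e] exp(i sum_j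
    e_j eta_j). Hence the quadratic form in [coin_prob]. *)
Definition coin_sign (J : finType) (s e : {ffun J -> bool}) : R :=
  \prod_j (-1) ^+ (s j && e j).

Definition coin_prob (J : finType) (psi : J -> J -> R) (s : {ffun J -> bool}) : R :=
  (4 ^+ #|J|)^-1 * kform (phase_kernel psi) (coin_sign s) (coin_sign s).

Lemma coin_prob_ge0 (J : finType) (psi : J -> J -> R) s :
  (forall i j, psi i j = psi j i) -> negative_type psi -> 0 <= coin_prob psi s.
Proof.
by move=> ? ?; rewrite mulr_ge0 ?invr_ge0 ?exprn_ge0//; exact: psd_phase_kernel.
Qed.

Definition fpull (J0 J : finType) (iota : J0 -> J) (s : {ffun J -> bool}) :=
  [ffun j => s (iota j)].

Lemma sum_ffun_bool_prod (J : finType) (F : J -> bool -> R) :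
  \sum_(s : {ffun J -> bool}) \prod_j F j (s j) = \prod_j (F j true + F j false).
Proof.
by rewrite -bigA_distr_bigA; apply: eq_bigr => j _; rewrite big_bool.
Qed.

(** * Marginals of the law of the coins *)

Section Marginal.
Variables (J0 J : finType) (iota : J0 -> J).
Hypothesis iota_inj : injective iota.
Let D := [pred j | j \notin codom iota].

Let cardJ : (#|J| = #|J0| + #|D|)%N.
Proof. by rewrite -(card_codom iota_inj) -(cardC (mem (codom iota))). Qed.

Let prodJ (F : J -> R) : \prod_j F j = (\prod_j F (iota j)) * \prod_(j in D) F j.
Proof.
rewrite (bigID (mem (codom iota)))/=; congr (_ * _).
rewrite -[RHS](big_map iota xpredT) [RHS]big_uniq ?map_inj_uniq ?index_enum_uniq//.
by apply: eq_bigl => j; rewrite -[codom iota]/(map iota (enum J0)) enumT.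
Qed.

Let sumJ (V : nmodType) (F : J -> V) :
  \sum_j F j = (\sum_j F (iota j)) + \sum_(j in D) F j.
Proof.
rewrite (bigID (mem (codom iota)))/=; congr (_ + _).
rewrite -[RHS](big_map iota xpredT) [RHS]big_uniq ?map_inj_uniq ?index_enum_uniq//.
by apply: eq_bigl => j; rewrite -[codom iota]/(map iota (enum J0)) enumT.
Qed.

Let fiber_sum (F : J -> bool -> R) s0 :
  \sum_(s | fpull iota s == s0) \prod_j F j (s j) =
  (\prod_j F (iota j) (s0 j)) * \prod_(j in D) (F j true + F j false).
Proof.
(* [c] spreads the constraint over the coordinates, so that the constrained sum becomes an
   unconstrained sum of products. *)
pose c j b := [forall j0, (iota j0 == j) ==> (b == s0 j0)].
rewrite big_mkcond/= (eq_bigr (fun s : {ffun J -> bool} =>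
    \prod_j ((c j (s j))%:R * F j (s j)))); last first.
  move=> s _; rewrite big_split/=; case: (fpull iota s =P s0) => [ss0|ns].
    rewrite [X in _ = X * _]big1 ?mul1r// => j _; rewrite (_ : c _ _ = true)//.
    apply/forallP => j0.
    by apply/implyP => /eqP <-; rewrite -ss0 ffunE.
  have [j0 js] : exists j0, s (iota j0) != s0 j0.
    apply: contra_notP ns => /forallNP h; apply/ffunP => j; rewrite ffunE.
    by apply/eqP/negPn/negP/h.
  rewrite (bigD1 (iota j0))//= (_ : c _ _ = false) ?mul0r//.
  by apply/negbTE/forallPn; exists j0; rewrite eqxx.
rewrite (sum_ffun_bool_prod (fun j b => (c j b)%:R * F j b)) prodJ; congr (_ * _).
  apply: eq_bigr => j _; have cE b : c (iota j) b = (b == s0 j).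
    apply/forallP/eqP => [/(_ j)/implyP/(_ (eqxx _))/eqP//|-> j0].
    by apply/implyP => /eqP/iota_inj ->.
  by rewrite !cE; case: (s0 j); rewrite ?mul1r ?mul0r ?add0r ?addr0.
apply: eq_bigr => j jD; have cE b : c j b = true.
  apply/forallP => j0; apply/implyP => /eqP ij; move: jD.
  by rewrite inE -ij codom_f.
by rewrite !cE !mul1r.
Qed.

Let sum_agree (G : {ffun J0 -> bool} -> {ffun J0 -> bool} -> R) :
  \sum_(e : {ffun J -> bool}) \sum_(e' : {ffun J -> bool})
    (\prod_(j in D) (e j == e' j)%:R) * G (fpull iota e) (fpull iota e')
   = 2 ^+ #|D| * \sum_a \sum_a' G a a'.
Proof.
have fib1 a : \sum_(e | fpull iota e == a) 1 = 2 ^+ #|D| :> R.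
  have := fiber_sum (fun _ _ => 1) a.
  rewrite [X in _ = X * _]big1// mul1r [X in _ = X]prodr_const => <-.
  by apply: eq_bigr => e _; rewrite big1.
have fib2 (e : {ffun J -> bool}) a' :
    \sum_(e' | fpull iota e' == a') \prod_(j in D) (e j == e' j)%:R = 1 :> R.
  have := fiber_sum (fun j b => ((j \in D) ==> (e j == b))%:R) a'.
  rewrite [X in _ = X * _]big1 ?mul1r ?[X in _ = X]big1.
  - move=> H; apply: etrans H; apply: eq_bigr => e' _.
    by rewrite [LHS]big_mkcond; apply: eq_bigr => j _; case: ifP.
  - by move=> j ->; case: (e j); rewrite ?addr0 ?add0r.
  - by move=> j _; rewrite inE codom_f.
rewrite (partition_big (fpull iota) xpredT)//= mulr_sumr.
apply: eq_bigr => a _; rewrite -(fib1 a) mulr_suml; apply: eq_bigr => e /eqP ea.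
rewrite mul1r (partition_big (fpull iota) xpredT)//=; apply: eq_bigr => a' _.
under eq_bigr => e' /eqP e'a' do rewrite ea e'a'.
by rewrite -mulr_suml fib2 mul1r.
Qed.

(** Summing over a forgotten coin j kills the terms with e j != e' j and doubles the others. The
    common value of e and e' at j then disappears from the kernel and is summed out with another
    factor 2, which together consume the normalisation 4 of that coin. *)
Lemma coin_prob_marginal (psi : J -> J -> R) s0 :
  \sum_(s | fpull iota s == s0) coin_prob psi s =
  coin_prob (fun i j => psi (iota i) (iota j)) s0.
Proof.
rewrite /coin_prob -mulr_sumr.
pose K0 := phase_kernel (fun i j => psi (iota i) (iota j)).
have KE (e e' : {ffun J -> bool}) : (forall j, j \in D -> e j = e' j) ->
    phase_kernel psi e e' = K0 (fpull iota e) (fpull iota e').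
  move=> ee'; rewrite /K0 /phase_kernel !(sumJ (fun j => nat_of_bool (_ j))).
  rewrite (eq_bigr (fun j => nat_of_bool (e' j)) (P := mem D)); last by move=> j /ee' ->.
  rewrite eqn_add2r; congr (_ * expR _).
    by congr (_ == _)%:R; apply: eq_bigr => j _; rewrite ffunE.
  rewrite /kform sumJ [X in _ + X]big1 ?addr0; last first.
    by move=> j /ee' ej; rewrite big1// => k _; rewrite /bdiff ej subrr !mul0r.
  apply: eq_bigr => j _; rewrite sumJ [X in _ + X]big1 ?addr0; last first.
    by move=> k /ee' ek; rewrite /bdiff ek subrr mulr0 mul0r.
  by apply: eq_bigr => k _; rewrite /bdiff !ffunE.
pose G a a' := coin_sign s0 a * coin_sign s0 a' * K0 a a'.
have -> : \sum_(s | fpull iota s == s0) kform (phase_kernel psi) (coin_sign s) (coin_sign s)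
    = 2 ^+ #|D| * (2 ^+ #|D| * \sum_a \sum_a' G a a').
  rewrite -sum_agree mulr_sumr /kform exchange_big/=; apply: eq_bigr => e _.
  rewrite exchange_big mulr_sumr/=; apply: eq_bigr => e' _.
  pose F j (b : bool) : R := (-1) ^+ (b && e j) * (-1) ^+ (b && e' j).
  under eq_bigr do rewrite -big_split/=.
  rewrite -mulr_suml (fiber_sum F) /F big_split/= mulrA.
  have -> : \prod_(j in D) ((-1) ^+ (true && e j) * (-1) ^+ (true && e' j) +
      (-1) ^+ (false && e j) * (-1) ^+ (false && e' j)) =
      2 ^+ #|D| * \prod_(j in D) (e j == e' j)%:R :> R.
    rewrite -prodr_const -big_split/=; apply: eq_bigr => j _.
    by case: (e j); case: (e' j) => /=; rewrite ?(expr0,expr1,mulr1,mul1r,mulr0,mulrNN,addNr).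
  have [ee'|] := pselect (forall j, j \in D -> e j = e' j).
    rewrite KE// /G /coin_sign.
    rewrite [RHS]mulrA; congr (_ * _); rewrite mulrC; congr (_ * (_ * _));
      by apply: eq_bigr => j _; rewrite ffunE.
  move=> /existsNP[j /not_implyP[jD /eqP/negPf ej]].
  by rewrite (bigD1 j)//= ej !(mul0r, mulr0).
rewrite -/K0 cardJ exprD invfM -mulrA; congr (_ * _).
by rewrite [2 ^+ _ * (2 ^+ _ * _)]mulrA -exprMn -natrM mulKf ?expf_neq0.
Qed.

Lemma coin_expect_marginal (psi : J -> J -> R) (h : {ffun J0 -> bool} -> R) :
  \sum_s coin_prob psi s * h (fpull iota s) =
  \sum_s0 coin_prob (fun i j => psi (iota i) (iota j)) s0 * h s0.
Proof.
rewrite (partition_big (fpull iota) xpredT)//=; apply: eq_bigr => s0 _.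
under eq_bigr => s /eqP ss0 do rewrite ss0.
by rewrite -mulr_suml coin_prob_marginal.
Qed.
End Marginal.

(** The total mass is the marginal on the empty set of coins. *)
Lemma coin_prob_sum1 (J : finType) (psi : J -> J -> R) : \sum_s coin_prob psi s = 1.
Proof.
have inj0 : injective (fun v : void => match v return J with end) by case.
have := coin_expect_marginal inj0 psi (fun _ => 1).
under eq_bigr do rewrite mulr1; move=> ->.
pose s0 : {ffun void -> bool} := [ffun => true].
have u (s : {ffun void -> bool}) : s = s0 by apply/ffunP => -[].
rewrite (big_pred1 s0) => [|s]; last by rewrite /= [s]u eqxx.
rewrite /coin_prob card_void expr0 invr1 mul1r mulr1 /kform.
rewrite (big_pred1 s0) => [|s]; last by rewrite /= [s]u eqxx.
rewrite (big_pred1 s0) => [|s]; last by rewrite /= [s]u eqxx.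
rewrite /coin_sign big1 ?mul1r; last by case.
by rewrite /phase_kernel eqxx /kform big1 ?expR0 ?mul1r//; case.
Qed.

(** Given the phases a coin has mean sign cos eta, and E cos eta_a cos eta_b = E cos (eta_a - eta_b)
    / 2 because the uniform phase removes the other half. On two coins this becomes a finite sum,
    where only the pairs with e' complementary to e survive the summation over s. *)
Lemma coin_correlation (J : finType) (psi : J -> J -> R) (a b : J) :
  (forall i j, psi i j = psi j i) -> psi a a = 0 -> psi b b = 0 -> a != b ->
  \sum_s coin_prob psi s * ((-1) ^+ s a * (-1) ^+ s b) = 2^-1 * expR (- 2 * psi a b).
Proof.
move=> psiC paa pbb ab; pose iota (i : bool) := if i then a else b.
have iinj : injective iota.
  by move=> [] [] //= => /eqP; rewrite ?(negPf ab)// eq_sym (negPf ab).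
have := coin_expect_marginal iinj psi (fun s => (-1) ^+ s true * (-1) ^+ s false).
under eq_bigr do rewrite !ffunE/=; move=> ->.
pose psi0 (i j : bool) := psi (iota i) (iota j); rewrite -/psi0.
rewrite (eq_bigr (fun s : {ffun bool -> bool} => (4 ^+ 2)^-1 * \sum_e \sum_e' phase_kernel psi0 e
  e' *
   \prod_j ((-1) ^+ (s j && ~~ (e j (+) e' j))))); last first.
  move=> s _; rewrite /coin_prob card_bool -mulrA; congr (_ * _).
  rewrite /kform mulr_suml; apply: eq_bigr => e _.
  rewrite mulr_suml; apply: eq_bigr => e' _.
  rewrite /coin_sign !big_bool/= mulrC.
  case: (s true); case: (s false); case: (e true); case: (e false); case: (e' true);
    case: (e' false) => /=;
   rewrite ?(expr0, expr1); ring.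
rewrite -mulr_sumr exchange_big/=.
pose F (e e' : {ffun bool -> bool}) (j : bool) (b : bool) : R :=
  (-1) ^+ (b && ~~ (e j (+) e' j)).
have KE (e : {ffun bool -> bool}) :
    phase_kernel psi0 e [ffun j => ~~ e j] = (1 - \prod_j (-1) ^+ e j) / 2 * expR (- 2 * psi a b).
  rewrite /phase_kernel /kform /bdiff !big_bool !ffunE /psi0 /iota paa pbb (psiC b a).
  case: (e true); case: (e false) => /=; rewrite ?(expr0, expr1, mulrNN, mulr1, subrr, mul0r)//;
  by congr (_ * expR _); field.
under eq_bigr => e _ do rewrite exchange_big/=.
have sE (e e' : {ffun bool -> bool}) :
    \sum_(s : {ffun bool -> bool}) phase_kernel psi0 e e' * \prod_j F e e' j (s j) =
    (e' == [ffun j => ~~ e j])%:R * 4 * phase_kernel psi0 e e'.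
  rewrite -mulr_sumr sum_ffun_bool_prod mulrC; congr (_ * _).
  case: eqP => [->|ne].
    by rewrite /F big_bool !ffunE; case: (e true); case: (e false) => /=; ring.
  have [j ej] : exists j, e j = e' j.
    apply: contra_notP ne => /forallNP h; apply/ffunP => j; rewrite ffunE.
    by have := h j; case: (e j); case: (e' j).
  by rewrite (bigD1 j)//= /F ej addbb/= expr0 expr1 addNr !mul0r.
rewrite (eq_bigr (fun e : {ffun bool -> bool} => 2 * expR (- 2 * psi a b) * (1 - \prod_j (-1) ^+
  e j))); last first.
  move=> e _; rewrite (bigD1 [ffun j => ~~ e j])//= sE eqxx mul1r KE [X in _ + X]big1 ?addr0;
    last first.
    by move=> e' /negPf ee'; rewrite sE ee' !mul0r.
  by field.
rewrite -mulr_sumr sumrB (sum_ffun_bool_prod (fun _ b => (-1) ^+ b)) big_bool/=.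
rewrite sumr_const card_ffun card_bool expr0 expr1 addNr mul0r subr0; by field.
Qed.
End Coins.

(** * Random cuts of finite sets *)

Section FiniteCutMeasure.
Context {R : realType} {X : choiceType} (psi : X -> X -> R).
Hypothesis psiC : forall x y, psi x y = psi y x.
Hypothesis psi0 : forall x, psi x x = 0.
Hypothesis psin : forall (I : finType) (x : I -> X),
  negative_type (fun i j => psi (x i) (x j)).

(** All coins at one point share its phase, so the number of the coin does not enter the kernel. *)
Definition coin_kernel (F : {fset X}) n (a b : F * 'I_n.+1) : R :=
  psi (val a.1) (val b.1).

Definition heads (F : {fset X}) n (s : {ffun F * 'I_n.+1 -> bool}) (x : F) : nat :=
  \sum_i s (x, i).

Definition cut (F : {fset X}) n (s : {ffun F * 'I_n.+1 -> bool}) (k : nat) : set X :=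
  [set x | exists2 j : F, val j = x & (k < heads s j)%N].

Definition cut_freq (F : {fset X}) n (C : set (set X)) (s : {ffun F * 'I_n.+1 -> bool}) : R :=
  n.+1%:R^-1 * \sum_(k < n.+1) (cut s k \in C)%:R.

Definition cut_prob (F : {fset X}) n (C : set (set X)) : R :=
  \sum_s coin_prob (@coin_kernel F n) s * cut_freq C s.

Lemma coin_kernel_prob_ge0 (F : {fset X}) n s : 0 <= coin_prob (@coin_kernel F n) s.
Proof.
apply: coin_prob_ge0; first by move=> i j; exact: psiC.
exact: psin.
Qed.

Lemma cut_freq_ge0 (F : {fset X}) n C (s : {ffun F * 'I_n.+1 -> bool}) : 0 <= cut_freq C s.
Proof. by rewrite mulr_ge0// sumr_ge0. Qed.

Lemma cut_freq_le1 (F : {fset X}) n C (s : {ffun F * 'I_n.+1 -> bool}) : cut_freq C s <= 1.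
Proof.
rewrite /cut_freq ler_pdivrMl ?ltr0n// mulr1.
rewrite (_ : n.+1%:R = \sum_(k < n.+1) 1); last by rewrite sumr_const card_ord.
by apply: ler_sum => k _; case: (_ \in _).
Qed.

Lemma cut_prob_ge0 F n C : 0 <= cut_prob F n C.
Proof.
by apply: sumr_ge0 => s _; rewrite mulr_ge0 ?coin_kernel_prob_ge0 ?cut_freq_ge0.
Qed.

Lemma cut_prob_le1 F n C : cut_prob F n C <= 1.
Proof.
rewrite -(coin_prob_sum1 (@coin_kernel F n)); apply: ler_sum => s _.
by rewrite ler_piMr ?coin_kernel_prob_ge0 ?cut_freq_le1.
Qed.

Lemma cut_prob0 F n : cut_prob F n set0 = 0.
Proof.
rewrite /cut_prob big1// => s _; rewrite /cut_freq big1 ?mulr0// => k _.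
by rewrite in_set0.
Qed.

Lemma cut_probU F n C C' : C `&` C' = set0 ->
  cut_prob F n (C `|` C') = cut_prob F n C + cut_prob F n C'.
Proof.
move=> CC; rewrite /cut_prob -big_split; apply: eq_bigr => s _ /=.
rewrite -mulrDr /cut_freq -mulrDr -big_split; congr (_ * (_ * _)).
apply: eq_bigr => k _ /=; rewrite in_setU.
have := CC; rewrite -subset0; have [kC|] := boolP (cut s k \in C); last first.
  by rewrite add0r.
have [kC'|] := boolP (cut s k \in C'); last by rewrite addr0.
by move=> /(_ (cut s k)); case; split; exact: set_mem.
Qed.

(** Cylinders over finite sets are the clopen subsets of the compact space 2^X. One implication
    suffices by symmetry in S and S'. *)
Definition cylinder (F : {fset X}) (C : set (set X)) :=
  forall S S', (forall x, x \in F -> S x <-> S' x) -> C S -> C S'.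

(** With [f] the identity this is consistency under enlarging the finite set; with [f] a symmetry of
    [psi] it is invariance. *)
Lemma cut_prob_pull (F0 F : {fset X}) (f : X -> X) n C :
  injective f -> (forall x y, psi (f x) (f y) = psi x y) ->
  (forall x, x \in F0 -> f x \in F) -> cylinder F0 C ->
  cut_prob F n [set S | C (f @^-1` S)] = cut_prob F0 n C.
Proof.
move=> finj fpsi fF C0.
pose iota (a : F0 * 'I_n.+1) : F * 'I_n.+1 := ([` fF _ (valP a.1)]%fset, a.2).
have iinj : injective iota.
  by move=> [a i] [b j] [/finj/val_inj -> ->].
have := coin_expect_marginal iinj (@coin_kernel F n) (@cut_freq F0 n C).
rewrite {2}/coin_kernel/=; under [X in _ = X -> _]eq_bigr do under eq_fun do under eq_fun do
  rewrite fpsi.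
rewrite -[RHS]/(cut_prob F0 n C) => <-; apply: eq_bigr => s _; congr (_ * (_ * _)).
apply: eq_bigr => k _; congr (nat_of_bool _)%:R.
have K x : x \in F0 -> (f @^-1` cut s k) x <-> cut (fpull iota s) k x.
  move=> xF0; have hE : heads (fpull iota s) [` xF0]%fset = heads s [` fF _ xF0]%fset.
    apply: eq_bigr => i _; rewrite ffunE /iota; congr (nat_of_bool (s (_, _))).
    exact: val_inj.
  split=> [[j jx kj]|[j jx kj]].
    exists [` xF0]%fset => //; rewrite hE; congr (_ < heads s _)%N : kj.
    exact: val_inj.
  exists [` fF _ xF0]%fset => //; rewrite -hE; congr (_ < heads _ _)%N : kj.
  exact: val_inj.
apply/idP/idP => /set_mem h; apply/mem_set.
  by apply: C0 h => x; exact: K.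
by apply: (C0 _ (f @^-1` cut s k) _ h) => x xF; apply: iff_sym; exact: K.
Qed.

Definition cuts_between (x y : X) : set (set X) := [set S | S x /\ ~ S y \/ S y /\ ~ S x].

Lemma cut_freq_between (F : {fset X}) n (x y : F) (s : {ffun F * 'I_n.+1 -> bool}) :
  cut_freq (cuts_between (val x) (val y)) s =
  `|(heads s x)%:R - (heads s y)%:R| / n.+1%:R.
Proof.
rewrite mulrC /cut_freq; congr (_ * _).
have hle z : (heads s z <= n.+1)%N.
  by rewrite -[leqRHS]card_ord -sum1_card; apply: leq_sum => i _; exact: leq_b1.
have cE k z : cut s k (val z) <-> (k < heads s z)%N.
  by split=> [[j /val_inj -> //]|]; exists z.
have sE a : (a <= n.+1)%N -> \sum_(k < n.+1) (k < a)%N%:R = a%:R :> R.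
  move=> an; have -> : a%:R = \sum_(k < a) 1 :> R by rewrite sumr_const card_ord.
  rewrite (big_ord_widen _ (fun=> 1) an) [RHS]big_mkcond.
  by apply: eq_bigr => k _; case: ltnP.
have aux a b : (a <= b)%N -> (b <= n.+1)%N ->
    \sum_(k < n.+1) ((k < a)%N (+) (k < b)%N)%:R = `|a%:R - b%:R| :> R.
  move=> ab bn; rewrite distrC ger0_norm ?subr_ge0 ?ler_nat//.
  rewrite -(sE b)// -(sE a) ?(leq_trans ab)// -sumrB; apply: eq_bigr => k _.
  have [ka|ka] := ltnP k a; first by rewrite (leq_trans ka ab) subrr.
  by rewrite addFb subr0.
rewrite (eq_bigr (fun k : 'I_n.+1 => ((k < heads s x)%N (+) (k < heads s y)%N)%:R)).
  have [xy|/ltnW yx] := leqP (heads s x) (heads s y); first exact: aux.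
  by rewrite distrC -aux//; apply: eq_bigr => k _; rewrite addbC.
move=> k _; congr (nat_of_bool _)%:R; apply/idP/idP => [/set_mem|].
  by rewrite /cuts_between/= !cE; do 2 case: (_ < _)%N => //; case=> -[].
move=> h; apply/mem_set; rewrite /cuts_between/= !cE; move: h.
by case: (_ < heads s x)%N; case: (_ < _)%N => //= _; [left|right].
Qed.

(** Squaring removes the absolute value of [cut_freq_between] and leaves a double sum of sign
    correlations. Every pair of coin numbers contributes 1 - e, and each of the n + 1 diagonal pairs
    adds 1: this is the remainder of order 1/n. *)
Lemma cut_freq_moment (F : {fset X}) n (x y : F) : x != y ->
  \sum_s coin_prob (@coin_kernel F n) s * cut_freq (cuts_between (val x) (val y)) s ^+ 2 =
  (1 - expR (- 2 * psi (val x) (val y))) / 4 + (4 * n.+1%:R)^-1.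
Proof.
move=> xy; set e := expR _; pose m : R := n.+1%:R.
have m0 : m != 0 by rewrite pnatr_eq0.
pose sg (s : {ffun F * 'I_n.+1 -> bool}) z i : R := (-1) ^+ s (z, i).
have hE s z : (heads s z)%:R = (m - \sum_i sg s z i) / 2 :> R.
  have -> : m = \sum_(i < n.+1) 1 by rewrite sumr_const card_ord.
  rewrite /heads natr_sum -sumrB mulr_suml.
  by apply: eq_bigr => i _; rewrite /sg; case: (s _) => /=; field.
have fE s : cut_freq (cuts_between (val x) (val y)) s ^+ 2 =
    (4 * m ^+ 2)^-1 * \sum_i \sum_j (sg s x i - sg s y i) * (sg s x j - sg s y j).
  rewrite cut_freq_between exprMn -normrX ger0_norm ?sqr_ge0// !hE.
  have -> : \sum_i \sum_j (sg s x i - sg s y i) * (sg s x j - sg s y j) =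
      (\sum_i (sg s x i - sg s y i)) ^+ 2.
    by rewrite expr2 mulr_suml; apply: eq_bigr => i _; rewrite mulr_sumr.
  rewrite sumrB -/m.
  by set a := \sum_i _; set b := \sum_i _; field.
under eq_bigr do rewrite fE mulrCA.
rewrite -mulr_sumr.
pose cor z i z' j := \sum_s coin_prob (@coin_kernel F n) s * (sg s z i * sg s z' j).
have corE z i z' j : (z, i) != (z', j) -> cor z i z' j = 2^-1 * expR (- 2 * psi (val z) (val z')).
  by move=> zz; rewrite /cor coin_correlation// => *; rewrite /coin_kernel ?psi0.
have corxx z i : cor z i z i = 1.
  rewrite /cor -(coin_prob_sum1 (@coin_kernel F n)); apply: eq_bigr => s _.
  by rewrite /sg -expr2 -exprM mulnC exprM sqrrN expr1n expr1n mulr1.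
have -> : \sum_s coin_prob (@coin_kernel F n) s *
    (\sum_i \sum_j (sg s x i - sg s y i) * (sg s x j - sg s y j)) =
    \sum_(i < n.+1) \sum_(j < n.+1) (1 - e + (i == j)%:R).
  under eq_bigr do rewrite mulr_sumr; rewrite exchange_big; apply: eq_bigr => i _.
  under eq_bigr do rewrite mulr_sumr; rewrite exchange_big; apply: eq_bigr => j _.
  transitivity (cor x i x j - cor x i y j - cor y i x j + cor y i y j).
    rewrite /cor -!sumrB -big_split; apply: eq_bigr => s _ /=; ring.
  have xiyj : (x, i) != (y, j) by rewrite xpair_eqE negb_and xy.
  have yixj : (y, i) != (x, j) by rewrite xpair_eqE negb_and eq_sym xy.
  rewrite !(corE x i y, corE y i x)// (psiC (val y)) -/e.
  have [->|ij] := eqVneq i j; first by rewrite !corxx /=; field.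
  by rewrite !corE ?xpair_eqE ?negb_and ?ij ?orbT// !psi0 mulr0 expR0 /=; field.
rewrite (eq_bigr (fun=> m * (1 - e) + 1)); last first.
  move=> i _; rewrite big_split/= sumr_const card_ord -mulr_natl; congr (_ + _).
  by rewrite (bigD1 i)//= eqxx big1 ?addr0// => j; rewrite eq_sym => /negPf ->.
rewrite sumr_const card_ord -mulr_natl -/m; by field.
Qed.

Lemma cut_prob_between (F : {fset X}) n (x y : X) : x \in F -> y \in F -> x != y ->
  (1 - expR (- 2 * psi x y)) / 4 <= cut_prob F n (cuts_between x y) /\
  cut_prob F n (cuts_between x y) ^+ 2 <=
    (1 - expR (- 2 * psi x y)) / 4 + (4 * n.+1%:R)^-1.
Proof.
move=> xF yF xy; have xyF : [` xF]%fset != [` yF]%fset by [].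
have := @cut_freq_moment F n _ _ xyF; rewrite /= => mE; split.
  apply: (@le_trans _ _ ((1 - expR (- 2 * psi x y)) / 4 + (4 * n.+1%:R)^-1)).
    by rewrite lerDl invr_ge0 mulr_ge0.
  rewrite -mE; apply: ler_sum => s _; rewrite ler_wpM2l ?coin_kernel_prob_ge0//.
  by rewrite expr2 ler_piMr ?cut_freq_ge0 ?cut_freq_le1.
rewrite -mE; set P := cut_prob _ _ _.
(* The upper bound is the nonnegativity of the variance; the lower bound was f^2 <= f for a
   frequency f in [0, 1]. *)
have : 0 <= \sum_s coin_prob (@coin_kernel F n) s * (cut_freq (cuts_between x y) s - P) ^+ 2.
  by apply: sumr_ge0 => s _; rewrite mulr_ge0 ?coin_kernel_prob_ge0 ?sqr_ge0.
rewrite (eq_bigr (fun s => coin_prob (@coin_kernel F n) s * cut_freq (cuts_between x y) s ^+ 2 -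
   (2 * P) * (coin_prob (@coin_kernel F n) s * cut_freq (cuts_between x y) s) +
   P ^+ 2 * coin_prob (@coin_kernel F n) s)); last by move=> s _; ring.
rewrite big_split sumrB/= -[X in _ - X + _]mulr_sumr -[X in _ + X]mulr_sumr.
rewrite -[X in 2 * P * X]/P coin_prob_sum1.
move=> h; rewrite -subr_ge0; apply: le_trans h _; rewrite le_eqVlt; apply/orP; left.
by apply/eqP; ring.
Qed.
End FiniteCutMeasure.

(** * Random cuts by ultralimits *)

Lemma ultra_fmap (S T : Type) (f : S -> T) (U : set_system S) :
  UltraFilter U -> UltraFilter (f @ U).
Proof.
move=> UU; split; first exact: fmap_proper_filter.
move=> G PG FG; apply/seteqP; split=> // A GA.
have [//|UnA] := in_ultra_setVsetC (f @^-1` A) UU.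
have GnA : G (~` A) by apply: FG.
have : G (A `&` ~` A) by apply: filterI.
by rewrite setICr => /filter_not_empty.
Qed.

Lemma ultra_bounded_cvg {R : realType} (S : Type) (U : set_system S) (f : S -> R) :
  UltraFilter U -> (forall s, 0 <= f s <= 1) -> cvg (f s @[s --> U]).
Proof.
move=> UU f01; have UfU := ultra_fmap f UU.
have := @segment_compact R 0 1; rewrite compact_ultra => /(_ _ UfU).
case=> [|l [_ fl]]; last by apply/cvg_ex; exists l.
suff : U (f @^-1` `[0, 1]) by [].
by apply: filterE => s /=; rewrite in_itv/= f01.
Qed.

Section CutUltrafilter.
Context {X : choiceType}.

Definition cofinal_sets : set_system ({fset X} * nat) :=
  [set A | exists F0 n0, forall F n, (F0 `<=` F)%fset -> (n0 <= n)%N -> A (F, n)].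

Instance cofinal_sets_proper : ProperFilter cofinal_sets.
Proof.
split.
  by move=> [F0 [n0 h]]; exact: (h F0 n0).
split=> [|A B [F0 [n0 hA]] [F1 [n1 hB]]|A B AB [F0 [n0 hA]]].
- by exists fset0, 0%N.
- exists (F0 `|` F1)%fset, (maxn n0 n1) => F n; rewrite fsubUset geq_max.
  by move=> /andP[? ?] /andP[? ?]; split; [exact: hA|exact: hB].
- by exists F0, n0 => F n ? ?; apply/AB/hA.
Qed.

Definition cut_ultra : set_system ({fset X} * nat) :=
  sval (cid (ultraFilterLemma cofinal_sets_proper)).

#[local] Instance cut_ultraP : UltraFilter cut_ultra.
Proof. by rewrite /cut_ultra; case: cid => U []. Qed.

Lemma cut_ultraW A : cofinal_sets A -> cut_ultra A.
Proof. by rewrite /cut_ultra; case: cid => U /= [_]; apply. Qed.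
End CutUltrafilter.

Section CutLimit.
Context {R : realType} {X : choiceType} (psi : X -> X -> R).
Hypothesis psiC : forall x y, psi x y = psi y x.
Hypothesis psi0 : forall x, psi x x = 0.
Hypothesis psin : forall (I : finType) (x : I -> X),
  negative_type (fun i j => psi (x i) (x j)).

Local Existing Instance cut_ultraP.

Definition cut_lim (C : set (set X)) : R :=
  lim (cut_prob psi Fn.1 Fn.2 C @[Fn --> @cut_ultra X]).

Lemma cut_limP C : cut_prob psi Fn.1 Fn.2 C @[Fn --> @cut_ultra X] --> cut_lim C.
Proof.
apply: ultra_bounded_cvg => -[F n].
by rewrite cut_prob_ge0 ?cut_prob_le1.
Qed.

Lemma cut_lim_ge0 C : 0 <= cut_lim C.
Proof. by apply: (cvgr_to_ge (@cut_limP C)); apply: nearW => Fn; exact: cut_prob_ge0. Qed.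

Lemma cut_lim0 : cut_lim set0 = 0.
Proof.
rewrite /cut_lim; under eq_fun do rewrite cut_prob0.
exact: lim_cst.
Qed.

Lemma cut_limU C C' : C `&` C' = set0 -> cut_lim (C `|` C') = cut_lim C + cut_lim C'.
Proof.
move=> CC; rewrite {1}/cut_lim; under eq_fun do rewrite cut_probU//.
by apply: cvg_lim => //; apply: cvgD; exact: cut_limP.
Qed.

(** Invariance holds before the limit: as soon as F contains [F0] and its image under [f], the two
    values coincide, so any ultrafilter finer than [cofinal_sets] gives an invariant limit. *)
Lemma cut_lim_pull (f : X -> X) F0 C :
  injective f -> (forall x y, psi (f x) (f y) = psi x y) -> cylinder F0 C ->
  cut_lim [set S | C (f @^-1` S)] = cut_lim C.
Proof.
move=> finj fpsi cC; apply: cvg_lim => //.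
apply: cvg_trans (@cut_limP C); apply: near_eq_cvg; apply: cut_ultraW.
exists (F0 `|` f @` F0)%fset, 0%N => F n;
  rewrite fsubUset => /andP[/fsubsetP F0F /fsubsetP fF] _ /=.
rewrite (@cut_prob_pull _ _ _ F0)//; last first.
  by move=> x xF0; apply: fF; apply: in_imfset.
exact: (@cut_prob_pull _ _ _ F0 F id).
Qed.

Lemma cut_lim_between x y : x != y ->
  (1 - expR (- 2 * psi x y)) / 4 <= cut_lim (cuts_between x y) /\
  cut_lim (cuts_between x y) ^+ 2 <= (1 - expR (- 2 * psi x y)) / 4.
Proof.
move=> xy; have h (F : {fset X}) : ([fset x; y] `<=` F)%fset -> x \in F /\ y \in F.
  by move=> /fsubsetP h; split; apply: h; rewrite !inE eqxx ?orbT.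
split.
  apply: (cvgr_to_ge (@cut_limP _)); apply: cut_ultraW.
  by exists [fset x; y]%fset, 0%N => F n /h[xF yF] _;
    case: (cut_prob_between psiC psi0 psin n xF yF xy).
apply/ler_addgt0Pr => e e0.
have H : cut_prob psi Fn.1 Fn.2 (cuts_between x y) ^+ 2 @[Fn --> @cut_ultra X]
    --> cut_lim (cuts_between x y) ^+ 2.
  by rewrite expr2; under eq_fun do rewrite expr2; apply: cvgM; exact: cut_limP.
apply: (cvgr_to_le H).
apply: cut_ultraW.
have /cvgrPdist_lt/(_ _ e0)[n0 _ hn0] := @cvg_harmonic R.
exists [fset x; y]%fset, n0 => F n /h[xF yF] n0n /=.
have [_ {}H] := cut_prob_between psiC psi0 psin n xF yF xy.
apply: le_trans H _; rewrite lerD2l.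
have /= := hn0 _ n0n; rewrite sub0r normrN ger0_norm ?invr_ge0// => /ltW; apply: le_trans.
by rewrite invfM ler_piMl ?invr_ge0// invf_le1// ler1n.
Qed.
End CutLimit.

(** * Measured walls from a negative type kernel *)

Definition half_spaces {X : Type} (S : set X) : set (set X) := [set S; ~` S].

Definition cuts_of {X : Type} (V : set (set (set X))) : set (set X) :=
  [set S | V (half_spaces S)].

Lemma is_wall_half_spaces (X : Type) (w : set (set X)) :
  is_wall w -> exists S, w = half_spaces S.
Proof. by move=> [A [_ _ ->]]; exists A. Qed.

(** Removing the trivial cuts, empty and full, leaves a space that is in general only locally
    compact; its compact open sets form a ring rather than an algebra. *)
Definition compact_open_walls {X : choiceType} : set (set (set (set X))) :=
  [set V | V `<=` @is_wall X /\ exists F, cylinder F (cuts_of V)].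

Lemma image_can_preimage (T : Type) (f g : T -> T) A :
  cancel f g -> cancel g f -> f @` A = g @^-1` A.
Proof.
move=> fK gK; apply/seteqP; split=> [_ [x Ax <-]|x Ax]; first by rewrite /= fK.
by exists (g x).
Qed.

Lemma wall_map_comp (X : Type) (s t : X -> X) w :
  wall_map (s \o t) w = wall_map s (wall_map t w).
Proof.
apply/seteqP; split=> [_ [A wA <-]|_ [_ [A wA <-] <-]].
  by exists (t @` A); [exists A|rewrite image_comp].
by exists A => //; rewrite image_comp.
Qed.

Lemma wall_map_id (X : Type) w : wall_map (@id X) w = w.
Proof. by apply/seteqP; split=> [_ [A wA <-]|A wA]; [|exists A]; rewrite ?image_id. Qed.

Lemma wall_map_can (X : Type) (s s' : X -> X) : cancel s s' -> cancel (wall_map s) (wall_map s').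
Proof.
move=> sK w; rewrite -wall_map_comp (_ : s' \o s = id) ?wall_map_id//.
by apply/funext => x; exact: sK.
Qed.

Section WallRing.
Context {X : choiceType}.
Notation cow := (@compact_open_walls X).

Lemma cylinderW (F F' : {fset X}) (C : set (set X)) :
  (F `<=` F')%fset -> cylinder F C -> cylinder F' C.
Proof. by move=> /fsubsetP FF' cC S S' SS'; apply: cC => x xF; apply/SS'/FF'. Qed.

Lemma compact_open_walls0 : cow set0.
Proof. by split=> //; exists fset0. Qed.

Lemma compact_open_wallsU : setU_closed cow.
Proof.
move=> V V' [VW [F cF]] [VW' [F' cF']]; split; first by rewrite subUset.
exists (F `|` F')%fset => S S' SS' [h|h]; [left|right].
  exact: (cylinderW (fsubsetUl F F') cF) h.
exact: (cylinderW (fsubsetUr F F') cF') h.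
Qed.

Lemma compact_open_wallsD : setD_closed cow.
Proof.
move=> V V' [VW [F cF]] [VW' [F' cF']]; split; first by move=> w [/VW].
exists (F `|` F')%fset => S S' SS' [h h']; split.
  exact: (cylinderW (fsubsetUl F F') cF) h.
move=> h1; apply: h'; apply: (cylinderW (fsubsetUr F F') cF') h1 => x xF.
by apply: iff_sym; exact: SS'.
Qed.

(* Compactness of [2^X]: a limit of the [s N] along an ultrafilter on [nat] would lie in
   the union but in none of its pieces. *)
Lemma compact_open_walls_bigcup (V : (set (set (set X)))^nat) :
  (forall i, cow (V i)) -> trivIset setT V -> cow (\bigcup_i V i) ->
  exists N, forall n, (N <= n)%N -> V n = set0.
Proof.
move=> cV tV [VW [F cF]]; apply: contrapT => noN.
have H N : exists S : set X, exists n, (N <= n)%N /\ V n (half_spaces S).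
  apply: contrapT => h; apply: noN; exists N => n Nn; rewrite -subset0 => w Vw.
  have [S wS] := is_wall_half_spaces ((cV n).1 _ Vw).
  by apply: h; exists S, n; rewrite -wS.
have [s sP] := choice H.
have [U [UU Uoo]] := ultraFilterLemma (@eventually_filter).
pose S : set X := [set x | U [set N | s N x]].
have US (F' : {fset X}) : U [set N | forall x, x \in F' -> S x <-> s N x].
  have h x : U [set N | S x <-> s N x].
    have [Ux|Unx] := in_ultra_setVsetC [set N | s N x] UU.
      by apply: filterS (Ux) => N /= sNx; split.
    apply: filterS (Unx) => N /= nsNx; split=> // Sx.
    have : U ([set N | s N x] `&` ~` [set N | s N x]) by apply: filterI.
    by rewrite setICr => /filter_not_empty.
  have UF' : U (\bigcap_(x in [set` F']) [set N | S x <-> s N x]).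
    by apply: filter_bigI => x _; exact: h.
  by apply: filterS UF' => N hN x xF; exact: hN.
have VS : (\bigcup_i V i) (half_spaces S).
  have /filter_ex[N sN] := US F.
  have [n [_ Vn]] := sP N.
  apply: (cF (s N)) => [x xF|]; first by apply: iff_sym; exact: sN.
  by exists n.
have [n _ VnS] := VS.
have [_ [F' cF']] := cV n.
have : U ([set N | forall x, x \in F' -> S x <-> s N x] `&` [set N | (n < N)%N]).
  by apply: filterI => //; apply: Uoo; exists n.+1.
move=> /filter_ex[N [/= SN nN]].
have VnN : V n (half_spaces (s N)) by apply: cF' VnS.
have [m [Nm VmN]] := sP N.
have mn : m = n by apply: tV => //; exists (half_spaces (s N)).
by move: nN; rewrite ltnNge -mn Nm.
Qed.
End WallRing.

(** * The content on walls and its Caratheodory extension *)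

Definition wall_ring_type (X : choiceType) := set (set X).
Definition wall_ring_display : measure_display.
Proof. exact: default_measure_display. Qed.
HB.instance Definition _ (X : choiceType) := Pointed.on (wall_ring_type X).
HB.instance Definition _ (X : choiceType) :=
  @isRingOfSets.Build wall_ring_display (wall_ring_type X) compact_open_walls
    compact_open_walls0 compact_open_wallsU compact_open_wallsD.

Section WallContent.
Context {R : realType} {X : choiceType} (psi : X -> X -> R).
Hypothesis psiC : forall x y, psi x y = psi y x.
Hypothesis psi0 : forall x, psi x x = 0.
Hypothesis psin : forall (I : finType) (x : I -> X),
  negative_type (fun i j => psi (x i) (x j)).

Definition rescaled (k : nat) (x y : X) : R := 4 ^- k * psi x y.

Lemma rescaledC k x y : rescaled k x y = rescaled k y x.
Proof. by rewrite /rescaled psiC. Qed.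

Lemma rescaled0 k x : rescaled k x x = 0.
Proof. by rewrite /rescaled psi0 mulr0. Qed.

Lemma rescaled_negative_type k (I : finType) (x : I -> X) :
  negative_type (fun i j => rescaled k (x i) (x j)).
Proof.
move=> c c0; rewrite (_ : kform _ _ _ = 4 ^- k * kform (fun i j => psi (x i) (x j)) c c).
  by rewrite mulr_ge0_le0 ?invr_ge0 ?exprn_ge0//; exact: psin.
rewrite /kform mulr_sumr; apply: eq_bigr => i _; rewrite mulr_sumr.
by apply: eq_bigr => j _; rewrite /rescaled; ring.
Qed.

(** Each term is the image of the law of a random cut under the two-to-one map [half_spaces]. *)
Definition wall_content (V : set (wall_ring_type X)) : \bar R :=
  (\sum_(k <oo) (cut_lim (rescaled k) (cuts_of V))%:E)%E.

Let cl_ge0 k V : (0 <= (cut_lim (rescaled k) (cuts_of V))%:E)%E.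
Proof.
rewrite lee_fin; apply: cut_lim_ge0; first exact: rescaledC.
exact: rescaled_negative_type.
Qed.

Lemma wall_content0 : wall_content set0 = 0%E.
Proof.
rewrite /wall_content eseries0// => k _ _.
by rewrite (_ : cuts_of set0 = set0)// cut_lim0.
Qed.

Lemma wall_content_ge0 V : (0 <= wall_content V)%E.
Proof. by apply: nneseries_ge0 => k _ _; exact: cl_ge0. Qed.

Lemma wall_contentU V V' : V `&` V' = set0 ->
  wall_content (V `|` V') = (wall_content V + wall_content V')%E.
Proof.
move=> VV'; rewrite /wall_content -nneseriesD//; try by move=> *; exact: cl_ge0.
apply: eq_eseriesr => k _; rewrite -EFinD -cut_limU//.
- exact: rescaledC.
- exact: rescaled_negative_type.
- rewrite -subset0 => S [h h'].
  by have : (V `&` V') (half_spaces S) by []; rewrite VV'.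
Qed.

(** By compactness a disjoint sequence whose union stays in the ring has finitely many nonempty
    terms, so finite additivity suffices. *)
Lemma wall_content_semi_sigma_additive : semi_sigma_additive wall_content.
Proof.
move=> V mV tV mUV; have [N hN] := compact_open_walls_bigcup mV tV mUV.
have fin n : (\sum_(0 <= i < n) wall_content (V i))%E =
    wall_content [set w | exists2 i, (i < n)%N & V i w].
  elim: n => [|n IH].
    rewrite big_nil -wall_content0; congr wall_content.
    by apply/esym; rewrite -subset0 => w [].
  rewrite big_nat_recr//= IH -wall_contentU.
    congr wall_content; apply/seteqP; split=> w.
      by move=> [[i ni Vi]|Vn]; [exists i => //; exact: ltnW|exists n].
    move=> [i]; rewrite ltnS leq_eqVlt => /predU1P[->|ni] Vi; first by right.
    by left; exists i.
  rewrite -subset0 => w [[i ni Vi] Vn].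
  have ii : i = n by apply: tV => //; exists w.
  by move: ni; rewrite ii ltnn.
apply: cvg_near_cst; exists N => // n /= Nn; rewrite fin; congr wall_content.
apply/seteqP; split=> [w [i _ Vi]|w [i _ Vi]]; first by exists i.
exists i => //; apply: leq_trans Nn; rewrite ltnNge; apply/negP => /hN Vi0.
by move: Vi; rewrite Vi0.
Qed.

HB.instance Definition _ := isMeasure.Build wall_ring_display (wall_ring_type X) R
  wall_content wall_content0 wall_content_ge0 wall_content_semi_sigma_additive.

Definition wall_outer : set (wall_ring_type X) -> \bar R := mu_ext wall_content.
HB.instance Definition _ := OuterMeasure.on wall_outer.

Let W : set (wall_ring_type X) := @is_wall X.

(** The set of all walls need not lie in the ring. But a set that contains a non-wall has no cover
    by ring elements, so its outer measure is the infimum of the empty set, +oo. *)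
Lemma wall_outer_is_wall : wall_outer.-caratheodory W.
Proof.
apply: le_caratheodory_measurable => E.
have [EW|nEW] := pselect (E `<=` W).
  rewrite setIidl// (_ : E `&` ~` W = set0) ?outer_measure0 ?adde0//.
  by rewrite -subset0 => w [/EW].
rewrite [leRHS](_ : _ = +oo%E) ?leey//.
rewrite -[LHS]/(mu_ext wall_content E) /mu_ext.
rewrite (_ : measurable_cover E = set0) ?image_set0 ?ereal_inf0//.
rewrite -subset0 => V [mV EV]; apply: nEW => w /EV[i _ Vw].
exact: (mV i).1 Vw.
Qed.

Definition caratheodory_walls : set (set (set (set X))) :=
  [set V | V `<=` W /\ wall_outer.-caratheodory V].

Lemma compact_open_caratheodory V : compact_open_walls V -> caratheodory_walls V.
Proof.
move=> cV; split; first exact: cV.1.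
by apply: (@sub_caratheodory _ (wall_ring_type X) R wall_content); apply: sub_sigma_algebra.
Qed.

Lemma wall_outer_compact_open V : compact_open_walls V -> wall_outer V = wall_content V.
Proof. by move=> cV; apply: measurable_mu_extE. Qed.

Lemma caratheodory_walls_sigma : sigma_algebra W caratheodory_walls.
Proof.
split.
- by split=> //; exact: caratheodory_measurable_set0.
- move=> A [AW cA]; split; first by move=> w [].
  by apply: caratheodory_measurable_setD => //; exact: wall_outer_is_wall.
- move=> A cA; split; first by move=> w [n _ /(cA n).1].
  by apply: caratheodory_measurable_bigcup => n; exact: (cA n).2.
Qed.

(** Intersecting with the walls gives mass 0 to the non-walls, where the outer measure would be
    infinite. *)
Definition wall_mu (A : set (g_sigma_algebraType caratheodory_walls)) : \bar R :=
  wall_outer (A `&` W).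

Lemma caratheodory_wallsI A : <<s caratheodory_walls >> A -> wall_outer.-caratheodory (A `&` W).
Proof.
move: A; apply: smallest_sub.
  split.
  - by rewrite /= set0I; exact: caratheodory_measurable_set0.
  - move=> A cA; rewrite /= setTD (_ : ~` A `&` W = W `\` (A `&` W)).
      by apply: caratheodory_measurable_setD => //; exact: wall_outer_is_wall.
    by rewrite setDIr setDv setU0 setIC.
  - move=> A cA; rewrite /= setI_bigcupl.
    by apply: caratheodory_measurable_bigcup => n; exact: cA.
move=> A [AW cA] /=; rewrite setIidl//.
Qed.

Lemma wall_mu0 : wall_mu set0 = 0%E.
Proof. by rewrite /wall_mu set0I outer_measure0. Qed.

Lemma wall_mu_ge0 A : (0 <= wall_mu A)%E.
Proof. exact: outer_measure_ge0. Qed.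

Lemma wall_mu_semi_sigma_additive : semi_sigma_additive wall_mu.
Proof.
move=> A mA tA mUA; rewrite /wall_mu setI_bigcupl.
apply: caratheodory_measure_sigma_additive.
- by move=> i; apply: caratheodory_wallsI; exact: mA.
- by apply: trivIset_setIr.
- by rewrite -setI_bigcupl; apply: caratheodory_wallsI.
Qed.

HB.instance Definition _ := isMeasure.Build _ (g_sigma_algebraType caratheodory_walls) R
  wall_mu wall_mu0 wall_mu_ge0 wall_mu_semi_sigma_additive.

Lemma cuts_of_between x y : cuts_of (walls_between W x y) = cuts_between x y.
Proof.
apply/seteqP; split=> S.
  move=> [_ [A AS [Ax Ay]]]; case: AS => AE; [left|right]; rewrite AE in Ax Ay => //.
  by split=> //; exact: contrapT.
move=> [[Sx Sy]|[Sy Sx]]; split.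
- by exists S; split=> //; [exists x|exists y].
- by exists S => //; left.
- by exists S; split=> //; [exists y|exists x].
- by exists (~` S); [right|split].
Qed.

Lemma walls_between_compact_open x y : compact_open_walls (walls_between W x y).
Proof.
split; first by move=> w [].
exists [fset x; y]%fset => S S' SS'; rewrite cuts_of_between /cuts_between/=.
by rewrite !SS' ?inE ?eqxx ?orbT.
Qed.

Lemma psi_ge0 x y : 0 <= psi x y.
Proof.
have /= := psin (fun b : bool => if b then x else y) (c := fun b => if b then 1 else -1).
rewrite /kform !big_bool/= !psi0 (psiC y x) subrr => /(_ erefl).
by rewrite !mulr0 !mul1r !mulr1 !mulN1r add0r addr0 -opprD oppr_le0 -mulr2n pmulrn_lge0.
Qed.

(** From 1 - exp(-2t) <= 2t at t = 4^-k psi, the square of the mass is at most 2 psi / 4^(k+1). *)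
Lemma cut_lim_rescaled_le k x y :
  cut_lim (rescaled k) (cuts_between x y) <= Num.sqrt (2 * psi x y) / 2 ^+ k.+1.
Proof.
have [->|xy] := eqVneq x y.
  rewrite (_ : cuts_between y y = set0) ?cut_lim0 ?divr_ge0 ?sqrtr_ge0 ?exprn_ge0//.
  by rewrite -subset0 => S [[]|[]].
have [_] := cut_lim_between (@rescaledC k) (@rescaled0 k) (@rescaled_negative_type k) xy.
move=> h; have cl0 := cut_lim_ge0 (@rescaledC k) (@rescaled_negative_type k) (cuts_between x y).
rewrite -(@ler_pXn2r _ 2) ?nnegrE ?divr_ge0 ?sqrtr_ge0 ?exprn_ge0//.
apply: le_trans h _; rewrite exprMn sqr_sqrtr ?mulr_ge0 ?psi_ge0// exprVn -exprM mulnC exprM.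
have := expR_ge1Dx (- 2 * rescaled k x y); rewrite /rescaled => h.
rewrite (_ : 2 ^+ 2 = 4 :> R); last by rewrite -natrX.
rewrite exprS invfM; have k0 : 0 < 4 ^+ k :> R by rewrite exprn_gt0.
have -> : 2 * psi x y * (4^-1 * 4 ^- k) = (2 * (4 ^- k * psi x y)) / 4 by ring.
by rewrite ler_pM2r// lerBlDl -lerBlDr; apply: le_trans h; rewrite mulNr.
Qed.

(** At this scale the rescaled kernel is at least 1, and 1 - exp(-2) >= 1/2. *)
Lemma cut_lim_rescaled_ge k x y : 4 ^+ k <= psi x y ->
  8^-1 <= cut_lim (rescaled k) (cuts_between x y).
Proof.
move=> kpsi; have k0 : 0 < 4 ^+ k :> R by rewrite exprn_gt0.
have xy : x != y.
  by apply: contraTneq kpsi => ->; rewrite psi0 -ltNge.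
have [+ _] := cut_lim_between (@rescaledC k) (@rescaled0 k) (@rescaled_negative_type k) xy.
apply: le_trans; have r1 : 1 <= rescaled k x y by rewrite /rescaled ler_pdivlMl ?mulr1.
have e2 : expR (- 2 * rescaled k x y) <= 2^-1.
  rewrite mulNr expRN lef_pV2 ?posrE ?expR_gt0//.
  by apply: le_trans (expR_ge1Dx _); lra.
lra.
Qed.

Lemma wall_content_between x y :
  (wall_content (walls_between W x y) <= (Num.sqrt (2 * psi x y))%:E)%E.
Proof.
rewrite /wall_content cuts_of_between.
have := @cvg_geometric_eseries_half R (Num.sqrt (2 * psi x y)) 0.
rewrite expr0 divr1 => /cvg_lim <-//.
apply: lee_nneseries => [k _ _|k _]; first by rewrite -cuts_of_between cl_ge0.
by rewrite lee_fin addn1 natrX; exact: cut_lim_rescaled_le.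
Qed.

(** Each of the scales k < N contributes at least 1/8. *)
Lemma wall_content_between_ge N x y : 4 ^+ N <= psi x y ->
  ((N%:R / 8)%:E <= wall_content (walls_between W x y))%E.
Proof.
move=> Npsi; rewrite /wall_content.
apply: le_trans (nneseries_lim_ge (m := 0) N _); last by move=> k _ _; exact: cl_ge0.
rewrite sumEFin lee_fin big_mkord (_ : _ / 8 = \sum_(k < N) 8^-1); last first.
  by rewrite sumr_const card_ord mulr_natl.
apply: ler_sum => k _.
rewrite cuts_of_between; apply: cut_lim_rescaled_ge; apply: le_trans Npsi.
by rewrite ler_weXn2l ?ler1n// ltnW// ltn_ord.
Qed.

Lemma wall_mu_between x y :
  wall_mu (walls_between W x y) = wall_content (walls_between W x y).
Proof.
rewrite /wall_mu setIidl; last by move=> w [].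
exact/wall_outer_compact_open/walls_between_compact_open.
Qed.

Lemma wall_mu_setC : wall_mu (~` W) = 0%E.
Proof. by rewrite /wall_mu setICl outer_measure0. Qed.

Lemma wall_mu_between_fin x y : (wall_mu (walls_between W x y) < +oo)%E.
Proof. by rewrite wall_mu_between; apply: le_lt_trans (wall_content_between x y) _;
  rewrite ltry. Qed.

Definition negative_type_walls : measured_walls R X :=
  @MeasuredWalls R X W caratheodory_walls wall_mu
    (fun w Ww => Ww) (fun V cV => cV.1) caratheodory_walls_sigma wall_mu_setC
    (fun x y => compact_open_caratheodory (walls_between_compact_open x y))
    wall_mu_between_fin.

Lemma negative_type_walls_dist_le x y :
  wall_dist negative_type_walls x y <= Num.sqrt (2 * psi x y).
Proof.
rewrite /wall_dist -lee_fin fineK.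
  by rewrite /= wall_mu_between; exact: wall_content_between.
by rewrite ge0_fin_numE ?wall_mu_between_fin// wall_mu_ge0.
Qed.

Lemma negative_type_walls_dist_ge N x y :
  4 ^+ N <= psi x y -> N%:R / 8 <= wall_dist negative_type_walls x y.
Proof.
move=> Npsi; rewrite /wall_dist -lee_fin fineK.
  by rewrite /= wall_mu_between; exact: wall_content_between_ge.
by rewrite ge0_fin_numE ?wall_mu_between_fin// wall_mu_ge0.
Qed.

(** * Symmetries of the kernel act by automorphisms of the measured walls *)

Section Automorphism.
Variables (s s' : X -> X).
Hypotheses (sK : cancel s s') (s'K : cancel s' s).
Hypothesis psis : forall x y, psi (s x) (s y) = psi x y.

Lemma wall_map_half_spaces A : wall_map s' (half_spaces A) = half_spaces (s @^-1` A).
Proof.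
apply/seteqP; split=> [_ [B [->|->] <-]|B [->|->]]; rewrite ?(image_can_preimage _ s'K sK).
- by left.
- by right; rewrite preimage_setC.
- by exists A; [left|rewrite (image_can_preimage _ s'K sK)].
- by exists (~` A); [right|rewrite (image_can_preimage _ s'K sK) preimage_setC].
Qed.

Lemma is_wall_map w : is_wall w -> is_wall (wall_map s' w).
Proof.
move=> [A [[a Aa] [b Ab] ->]]; rewrite -/(half_spaces A) wall_map_half_spaces.
exists (s @^-1` A); split=> //; first by exists (s' a); rewrite /= s'K.
by exists (s' b); rewrite /= s'K.
Qed.

Lemma compact_open_walls_preimage V :
  (forall w, is_wall (wall_map s' w) -> is_wall w) ->
  compact_open_walls V -> compact_open_walls (wall_map s' @^-1` V) /\
    wall_content (wall_map s' @^-1` V) = wall_content V.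
Proof.
move=> isW [VW [F cF]].
have cE : cuts_of (wall_map s' @^-1` V) = [set S | cuts_of V (s @^-1` S)].
  by apply/seteqP; split=> S; rewrite /cuts_of/= wall_map_half_spaces.
split; last first.
  apply: eq_eseriesr => k _; rewrite cE; congr _%:E; apply: cut_lim_pull cF.
  - exact: rescaledC.
  - exact: rescaled_negative_type.
  - exact: can_inj sK.
  - by move=> x y; rewrite /rescaled psis.
split; first by move=> w /VW /isW.
exists (s @` F)%fset => S S' SS'; rewrite cE; apply: cF => x xF.
by apply: SS'; apply: in_imfset.
Qed.
End Automorphism.

(** Covers pull back to covers with the same content. Applied to the inverse map as well, this
    yields equality. *)
Lemma wall_outer_preimage_le (s s' : X -> X) E :
  cancel s s' -> cancel s' s -> (forall x y, psi (s x) (s y) = psi x y) ->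
  (wall_outer (wall_map s' @^-1` E) <= wall_outer E)%E.
Proof.
move=> sK s'K psis; apply: le_ereal_inf_tmp => _ [V [mV EV] <-].
have isW w : is_wall (wall_map s' w) -> is_wall w.
  by move=> /(is_wall_map s'K sK); rewrite (wall_map_can s'K).
apply: ereal_inf_lbound; exists (fun i => wall_map s' @^-1` V i).
  split=> [i|w /EV[i _ Vi]]; last by exists i.
  by have [] := compact_open_walls_preimage sK s'K psis isW (mV i).
apply: eq_eseriesr => i _.
by have [] := compact_open_walls_preimage sK s'K psis isW (mV i).
Qed.

Lemma wall_outer_preimage (s s' : X -> X) E :
  cancel s s' -> cancel s' s -> (forall x y, psi (s x) (s y) = psi x y) ->
  wall_outer (wall_map s' @^-1` E) = wall_outer E.
Proof.
move=> sK s'K psis; apply/eqP; rewrite eq_le (wall_outer_preimage_le _ sK s'K psis)/=.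
have psis' x y : psi (s' x) (s' y) = psi x y by rewrite -psis !s'K.
apply: le_trans (wall_outer_preimage_le (wall_map s' @^-1` E) s'K sK psis').
rewrite (_ : wall_map s @^-1` (wall_map s' @^-1` E) = E)//.
by apply/funext => w; rewrite /preimage/= (wall_map_can sK).
Qed.

Lemma caratheodory_walls_preimage (s s' : X -> X) V :
  cancel s s' -> cancel s' s -> (forall x y, psi (s x) (s y) = psi x y) ->
  caratheodory_walls V -> caratheodory_walls (wall_map s' @^-1` V).
Proof.
move=> sK s'K psis [VW cV]; split.
  by move=> w /VW /(is_wall_map s'K sK); rewrite (wall_map_can s'K).
move=> E; have EE : E = wall_map s' @^-1` (wall_map s @^-1` E).
  by apply/funext => w; rewrite /preimage/= (wall_map_can s'K).
rewrite {1}EE (wall_outer_preimage _ sK s'K psis) cV; congr (_ + _)%E.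
  by rewrite -(wall_outer_preimage _ sK s'K psis) preimage_setI -EE.
by rewrite -(wall_outer_preimage _ sK s'K psis) preimage_setI -EE.
Qed.

Lemma negative_type_walls_automorphism (s s' : X -> X) :
  cancel s s' -> cancel s' s -> (forall x y, psi (s x) (s y) = psi x y) ->
  wall_automorphism negative_type_walls s.
Proof.
move=> sK s'K psis.
have psis' x y : psi (s' x) (s' y) = psi x y by rewrite -psis !s'K.
have imE V : wall_map s @` V = wall_map s' @^-1` V.
  by apply: image_can_preimage; apply: wall_map_can.
have preK V : wall_map s @^-1` (wall_map s' @^-1` V) = V.
  by apply/funext => w; rewrite /preimage/= (wall_map_can sK).
split.
- by exists s'.
- move=> w; split; last exact: is_wall_map s'K sK _.
  by move=> /(is_wall_map sK s'K); rewrite (wall_map_can sK).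
- move=> V; rewrite imE; split; last exact: caratheodory_walls_preimage.
  by move=> /(caratheodory_walls_preimage s'K sK psis'); rewrite preK.
- move=> V [VW _]; rewrite imE -[LHS]/(wall_mu _) -[RHS]/(wall_mu _) /wall_mu.
  rewrite [in RHS]setIidl// setIidl; first exact: wall_outer_preimage.
  by move=> w /VW /(is_wall_map s'K sK); rewrite (wall_map_can s'K).
Qed.
End WallContent.

(** * L^p seminorms *)

Section LpSeminorm.
Context {R : realType} {d : measure_display} {T : measurableType d}.
Context (nu : {measure set T -> \bar R}) (p : R) (p1 : (1 <= p%:E)%E).
Implicit Types f g : T -> R.

Definition Lp_norm f : R := fine ('N[nu]_(p%:E)[EFin \o f])%E.
Local Notation inLp f := (f \in Lfun nu p%:E).

Let p1' : 1 <= p. Proof. by rewrite -lee_fin. Qed.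
Let p0 : 0 < p. Proof. exact: lt_le_trans p1'. Qed.

Lemma inLpP f : inLp f <->
  measurable_fun setT f /\ ('N[nu]_(p%:E)[EFin \o f] < +oo)%E.
Proof.
split=> [lf|[mf ff]]; last by apply/andP; split; apply/mem_set.
split; first exact: (set_mem (sub_Lfun_mfun lf)).
exact: (set_mem (sub_Lfun_finLfun lf)).
Qed.

Lemma inLpD f g : inLp f -> inLp g -> inLp (f \+ g).
Proof. by move=> lf lg; have [_ +] := Lfun_addr_closed nu p1; apply. Qed.

Lemma inLpZ a f : inLp f -> inLp (fun x => a * f x).
Proof.
move=> lf; have [l0 +] := Lfun_submod_closed nu p1.
move=> /(_ a f (fun=> 0) lf l0); rewrite (_ : a *: f + _ = fun x => a * f x)//.
by apply/funext => x; rewrite !fctE addr0.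
Qed.

Lemma inLpN f : inLp f -> inLp (\- f).
Proof.
by move/(inLpZ (-1)); rewrite (_ : (fun x => -1 * f x) = \- f)//; apply/funext => x; rewrite mulN1r.
Qed.

Lemma inLpB f g : inLp f -> inLp g -> inLp (f \- g).
Proof. by move=> lf /inLpN lg; exact: (inLpD lf lg). Qed.

Lemma Lp_normE f : inLp f -> (Lp_norm f)%:E = ('N[nu]_(p%:E)[EFin \o f])%E.
Proof. by move=> /inLpP[_ ff]; rewrite fineK// ge0_fin_numE// Lnorm_ge0. Qed.

Lemma Lp_norm_ge0 f : 0 <= Lp_norm f.
Proof. by rewrite fine_ge0// Lnorm_ge0. Qed.

Lemma eq_Lp_norm f g : f =1 g -> Lp_norm f = Lp_norm g.
Proof. by move=> /funext ->. Qed.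

Lemma Lp_norm_triangle f g : inLp f -> inLp g -> Lp_norm (f \+ g) <= Lp_norm f + Lp_norm g.
Proof.
move=> lf lg; rewrite -lee_fin EFinD !Lp_normE ?inLpD//.
by apply: eminkowski => //; [have [] := (inLpP f).1 lf|have [] := (inLpP g).1 lg].
Qed.

Lemma Lp_normN f : Lp_norm (\- f) = Lp_norm f.
Proof.
rewrite /Lp_norm (_ : EFin \o _ = (\- (EFin \o f))%E); last exact/funext.
by rewrite oppe_Lnorm.
Qed.

Lemma Lp_normBC f g : Lp_norm (f \- g) = Lp_norm (g \- f).
Proof. by rewrite -Lp_normN; apply: eq_Lp_norm => x /=; rewrite opprB. Qed.

Lemma Lp_norm_triangleB f g h : inLp f -> inLp g -> inLp h ->
  Lp_norm (f \- h) <= Lp_norm (f \- g) + Lp_norm (g \- h).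
Proof.
move=> lf lg lh; rewrite (@eq_Lp_norm (f \- h) ((f \- g) \+ (g \- h))).
  by rewrite Lp_norm_triangle// inLpB.
by move=> x /=; rewrite addrA subrK.
Qed.

Lemma Lp_norm_powR f : Lp_norm f `^ p = fine (\int[nu]_x (`|f x| `^ p)%:E)%E.
Proof. by rewrite -fine_poweR poweR_Lnorm// gt_eqF. Qed.

Lemma Lp_integrable f : inLp f -> nu.-integrable setT (fun x => (`|f x| `^ p)%:E).
Proof. exact: Lfun_integrable. Qed.

Lemma LspaceType_inLp (u : LspaceType nu p1) : inLp (u : T -> R).
Proof.
apply/inLpP; split.
  have mu := @measurable_funPT _ _ _ _ (repr (u : @aeEqMfun _ _ R T (measurableTypeR R) nu)).
  exact: mu.
exact: Lebesgue_finite.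
Qed.

Lemma Lp_distE (u v : LspaceType nu p1) : Lp_dist u v = Lp_norm ((u : T -> R) \- (v : T -> R)).
Proof. by []. Qed.

Lemma Lp_distC (u v : LspaceType nu p1) : Lp_dist u v = Lp_dist v u.
Proof. exact: Lp_normBC. Qed.

Lemma Lp_dist_ge0 (u v : LspaceType nu p1) : 0 <= Lp_dist u v.
Proof. exact: Lp_norm_ge0. Qed.

Lemma Lp_distxx (u : LspaceType nu p1) : Lp_dist u u = 0.
Proof.
rewrite Lp_distE (@eq_Lp_norm _ (cst 0)); last by move=> x /=; rewrite subrr.
by rewrite /Lp_norm -[EFin \o _]/(cst 0%E) Lnorm0// eqe gt_eqF.
Qed.

Lemma Lp_dist_triangle (v u w : LspaceType nu p1) :
  Lp_dist u w <= Lp_dist u v + Lp_dist v w.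
Proof. by rewrite !Lp_distE Lp_norm_triangleB// LspaceType_inLp. Qed.

(** The p-th power of the distance is the integral over x of the kernels |u_i(x) - u_j(x)|^p on the
    line, and negative type passes through the integral. *)
Lemma Lp_dist_powR_negative_type (I : finType) (u : I -> LspaceType nu p1) :
  p <= 2 -> negative_type (fun i j => Lp_dist (u i) (u j) `^ p).
Proof.
move=> p2 c c0; pose h (i j : I) (x : T) := `|(u i : T -> R) x - (u j : T -> R) x| `^ p.
have inth i j : nu.-integrable setT (EFin \o h i j).
  by apply: Lp_integrable; apply: inLpB; exact: LspaceType_inLp.
have intch i j : nu.-integrable setT (fun x => (c i * c j * h i j x)%:E).
  under eq_fun do rewrite EFinM.
  have K := integrableZl measurableT (c i * c j) (inth i j).
  exact: K.
have intsum i : nu.-integrable setT (fun x => (\sum_j c i * c j * h i j x)%:E).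
  by under eq_fun do rewrite -sumEFin; apply: integrable_sum.
rewrite (_ : kform _ c c = fine (\int[nu]_x (\sum_i \sum_j c i * c j * h i j x)%:E)%E).
  rewrite -lee_fin fineK; last first.
    apply: integrable_fin_num => //; under eq_fun do rewrite -sumEFin.
    by apply: integrable_sum => // i _; exact: intsum.
  rewrite -[leRHS](@integral0 _ _ _ nu setT); apply: le_integral => //.
  - under eq_fun do rewrite -sumEFin.
    by apply: integrable_sum => // i _; exact: intsum.
  - exact: integrable0.
  - move=> x _; rewrite lee_fin.
    by apply: (powR_dist_negative_type (fun i => (u i : T -> R) x)); rewrite ?p0.
rewrite /kform.
under [in RHS]eq_integral do rewrite -sumEFin.
rewrite integral_sum//.
transitivity (fine (\sum_i \sum_j c i * c j * Lp_dist (u i) (u j) `^ p)%:E) => //.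
rewrite -sumEFin; congr fine; apply: eq_bigr => i _.
under [in RHS]eq_integral do rewrite -sumEFin.
rewrite integral_sum// -sumEFin; apply: eq_bigr => j _.
under [in RHS]eq_integral do rewrite EFinM.
rewrite integralZl//; last exact: (inth i j).
rewrite [LHS]EFinM; congr (_ * _)%E.
rewrite Lp_distE Lp_norm_powR fineK//.
exact: integrable_fin_num (inth i j).
Qed.
End LpSeminorm.

(** * Bounded or proper wall actions imply bounded or proper L^p actions *)

Section WallDistance.
Context {R : realType} {X : Type} (S : measured_walls R X).

Lemma measurable_walls_between x y :
  measurable (walls_between (walls S) x y : set (g_sigma_algebraType (wall_algebra S))).
Proof. by apply: sub_sigma_algebra; exact: walls_between_in. Qed.

Lemma wall_dist_fineK x y :
  (wall_dist S x y)%:E = wall_measure S (walls_between (walls S) x y).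
Proof. by rewrite /wall_dist fineK// ge0_fin_numE// walls_between_fin. Qed.

Lemma separatesC w (x y : X) : is_wall w -> separates w x y -> separates w y x.
Proof.
move=> [A [_ _ ->]] [B [->|->] [Bx By]].
  by exists (~` A); [right|split=> // /(_ Bx)].
by exists A; [left|split=> //; apply: contrapT].
Qed.

Lemma walls_betweenC x y : walls_between (walls S) x y = walls_between (walls S) y x.
Proof.
by apply/seteqP; split=> w [Sw /(separatesC (walls_are_walls Sw))].
Qed.

Lemma walls_between_sub x y z : walls_between (walls S) x z `<=`
  walls_between (walls S) x y `|` walls_between (walls S) y z.
Proof.
move=> w [Sw [A wA [Ax Az]]]; have [Ay|nAy] := pselect (A y).
  by right; split=> //; exists A.
by left; split=> //; exists A.
Qed.

Lemma wall_dist_triangle x y z : wall_dist S x z <= wall_dist S x y + wall_dist S y z.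
Proof.
rewrite -lee_fin EFinD !wall_dist_fineK.
apply: (le_trans _ (measureU2 _ (measurable_walls_between x y) (measurable_walls_between y z))).
apply: le_measure; rewrite ?mem_set//; last exact: walls_between_sub.
- exact: measurable_walls_between.
- by apply: measurableU; exact: measurable_walls_between.
Qed.
End WallDistance.

Section WallsToLp.
Context {R : realType} {G : topologicalGroupType} (p : R) (p1 : (1 <= p%:E)%E).

(** The group acts on itself by left translation, with the walls of the kernel [psi] of an unbounded
    orbit. The lower bound on the wall distance makes this action unbounded, hence proper; the upper
    bound carries properness back to [psi]. *)
Lemma walls_bounded_or_proper_BP_Lp :
  p <= 2 -> walls_bounded_or_proper R G -> BP_Lp G p1.
Proof.
move=> p2 HW d T nu act [act1 actM] _ iso cont.
have p0 : 0 < p by rewrite (@lt_le_trans _ _ 1)// -lee_fin.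
have [|] := pselect (bounded_action (@Lp_dist _ _ _ nu p p1) act); first by left.
move=> /existsNP[v nbd]; right.
pose psi (g h : G) : R := Lp_dist (act g v) (act h v) `^ p.
have psiC g h : psi g h = psi h g by rewrite /psi Lp_distC.
have psi0 g : psi g g = 0 by rewrite /psi Lp_distxx powR0// gt_eqF.
have psin (I : finType) (x : I -> G) : negative_type (fun i j => psi (x i) (x j)).
  exact: (Lp_dist_powR_negative_type (fun i => act (x i) v)).
pose S := negative_type_walls psiC psi0 psin.
have psi_lt a g h : 0 <= a -> psi g h <= a -> Lp_dist (act g v) (act h v) <= a `^ p^-1.
  move=> a0 psia; have -> : Lp_dist (act g v) (act h v) = psi g h `^ p^-1.
    by rewrite -powRrM mulfV ?gt_eqF// powRr1// Lp_dist_ge0.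
  by rewrite ge0_ler_powR ?invr_ge0 ?nnegrE ?powR_ge0// ltW.
have act_psi g x y : psi (g * x)%g (g * y)%g = psi x y by rewrite /psi !actM iso.
have aut g : wall_automorphism S (fun x : G => (g * x)%g).
  apply: (@negative_type_walls_automorphism _ _ _ _ _ _ _ (fun x => g^-1 * x)%g).
  - by move=> x; rewrite mulKg.
  - by move=> x; rewrite mulVKg.
  - exact: act_psi.
have wcont : continuous_action (wall_dist S) (fun g x : G => (g * x)%g).
  move=> g x e e0; exists (e / 2); first by rewrite divr_gt0.
  have e20 : 0 < e / 2 by rewrite divr_gt0.
  (* With this choice dl^p = (e/2)^2 / 4, so psi <= dl^p gives sqrt (2 psi) <= (e/2) / sqrt 2 <
     e/2. *)
  pose dl := ((e / 2) ^+ 2 / 4) `^ p^-1.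
  have dl0 : 0 < dl by rewrite powR_gt0// divr_gt0// exprn_gt0.
  have [r r0] := cont g (act x v) dl dl0.
  apply: filterS => h hh y xy.
  have {}hh := hh (act x v); rewrite Lp_distxx -!actM in hh.
  apply: le_lt_trans (wall_dist_triangle S _ (h * x)%g _) _.
  rewrite (splitr e) ltr_leD//; last first.
    by rewrite (wall_automorphism_dist (aut h)) ltW.
  apply: le_lt_trans (negative_type_walls_dist_le _ _ _ _ _) _.
  rewrite -(ger0_norm (ltW e20)) -sqrtr_sqr ltr_sqrt ?exprn_gt0//.
  have : psi (g * x)%g (h * x)%g <= (e / 2) ^+ 2 / 4.
    have -> : (e / 2) ^+ 2 / 4 = dl `^ p.
      by rewrite -powRrM mulVf ?gt_eqF// powRr1// ltW// divr_gt0// exprn_gt0.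
    by rewrite ge0_ler_powR ?nnegrE ?Lp_dist_ge0 ?ltW//; exact: hh.
  have : 0 < (e / 2) ^+ 2 by rewrite exprn_gt0.
  lra.
have gact : group_action (fun g x : G => (g * x)%g).
  by split=> [x|g h x]; rewrite ?mul1g ?mulgA.
have [bW|pW] := HW G S _ gact aut wcont.
  exfalso; have [M hM] := bW 1%g; apply: nbd.
  have [N MN] : exists N : nat, M < N%:R / 8.
    exists (Num.bound (`|M| * 8)); rewrite ltr_pdivlMr//.
    apply: le_lt_trans (archi_boundP _); by rewrite ?ler_wpM2r ?ler_norm ?mulr_ge0.
  exists ((4 ^+ N) `^ p^-1) => g h; apply: psi_lt; first by rewrite exprn_ge0.
  rewrite leNgt; apply/negP => /ltW /(negative_type_walls_dist_ge psiC psi0 psin) h1.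
  by have := hM g h; rewrite !mulg1 leNgt (lt_le_trans MN).
move=> u; apply/cvgryPge => A.
(* [B] absorbs the cost of passing from the orbit of v to that of u; the maximum with 0 allows p-th
   powers to be compared. *)
pose B := Num.max 0 (A + Lp_dist u v + Lp_dist v u).
have B0 : 0 <= B by rewrite le_max lexx.
have /cvgryPge/(_ (Num.sqrt (2 * B `^ p) + 1)) := pW 1%g.
apply: filterS => g; rewrite mulg1 => hg.
have {}hg : Num.sqrt (2 * B `^ p) < Num.sqrt (2 * psi g 1%g).
  apply: (@lt_le_trans _ _ (Num.sqrt (2 * B `^ p) + 1)); first by rewrite ltrDl.
  by apply: le_trans hg _; exact: negative_type_walls_dist_le.
have {}hg : B `^ p < psi g 1%g.
  have pg : 0 < 2 * psi g 1%g by rewrite -sqrtr_gt0 (le_lt_trans (sqrtr_ge0 _) hg).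
  by move: hg; rewrite ltr_sqrt// ltr_pM2l.
have {}hg : B <= Lp_dist (act g v) v.
  rewrite leNgt; apply/negP => hB; move: hg; rewrite ltNge /psi act1 => /negP; apply.
  by apply: ge0_ler_powR; rewrite ?nnegrE ?Lp_dist_ge0 ?(ltW p0) ?(ltW hB).
have : A + Lp_dist u v + Lp_dist v u <= B by rewrite le_max lexx orbT.
have h1 := Lp_dist_triangle (act g u) (act g v) v.
have h2 := Lp_dist_triangle u (act g u) v.
rewrite iso in h1; lra.
Qed.
End WallsToLp.

(** * The continuous part of a measure-preserving action *)

Section NearUnit.
Context {G : topologicalGroupType}.

Lemma near_mulgl (g : G) (P : set G) :
  (\forall h \near (1%g : G), P h) -> \forall h \near g, P (g^-1 * h)%g.
Proof.
move=> P1; have : (fun h => g^-1 * h)%g @ g --> (1%g : G).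
  rewrite -[X in _ --> X](mulVg g).
  have K := @mulg_continuous G (g^-1, g)%g.
  apply: (cvg_comp (fun h => (g^-1, h)%g) (fun x : G * G => (x.1 * x.2)%g) _ K).
  by apply: cvg_pair; [exact: cvg_cst|exact: cvg_id].
exact.
Qed.

Lemma near_invg (P : set G) :
  (\forall h \near (1%g : G), P h) -> \forall h \near (1%g : G), P h^-1%g.
Proof.
have : (fun h : G => h^-1)%g @ (1%g : G) --> (1^-1)%g := @invg_continuous G 1%g.
by rewrite invg1; apply.
Qed.

Lemma near_conjg (g : G) (P : set G) :
  (\forall h \near (1%g : G), P h) -> \forall h \near (1%g : G), P (g^-1 * h * g)%g.
Proof.
move=> P1; have : (fun h => g^-1 * h * g)%g @ (1%g : G) --> (1%g : G).
  rewrite -[X in _ --> X](mulVg g) -[X in _ --> (X * _)%g](mulg1 (g^-1)%g).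
  have K h k := @mulg_continuous G (h, k).
  apply: (cvg_comp (fun h => (g^-1 * h, g)%g) (fun x : G * G => (x.1 * x.2)%g) _ (K _ _)).
  apply: cvg_pair; last exact: cvg_cst.
  apply: (cvg_comp (fun h => (g^-1, h)%g) (fun x : G * G => (x.1 * x.2)%g) _ (K _ _)).
  by apply: cvg_pair; [exact: cvg_cst|exact: cvg_id].
exact.
Qed.
End NearUnit.

Section ContinuousPart.
Context {R : realType} {G : topologicalGroupType} {d : measure_display}.
Context {T : measurableType d} (mu : {measure set T -> \bar R}) (tau : G -> T -> T).
Hypothesis tau1 : forall w, tau 1%g w = w.
Hypothesis tauM : forall g h w, tau (g * h)%g w = tau h (tau g w).
Hypothesis mtau : forall g, measurable_fun setT (tau g).
Hypothesis mutau : forall g A, measurable A -> mu (tau g @^-1` A) = mu A.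

(** [tau] is a right action, so the preimage under [tau g] plays the role of the translate gA. The
    one-sided difference controls the other one: mu(gA \ A) = mu(A \ g^-1 A) by invariance. *)
Definition continuously_moved : set (set T) := [set A |
  [/\ measurable A, (mu A < +oo)%E & forall e : R, 0 < e ->
    \forall g \near (1%g : G), (mu (A `\` tau g @^-1` A) < e%:E)%E]].

(** Continuously moved sets have finite measure, so they form only a delta-ring; its multipliers
    form a sigma-algebra on the whole space. They need not be measurable for the original
    structure. *)
Definition locally_continuously_moved : set (set T) :=
  [set A | forall E, continuously_moved E -> continuously_moved (A `&` E)].

Definition sigma_continuously_moved (A : set T) :=
  exists2 E : nat -> set T, (forall n, continuously_moved (E n)) & A = \bigcup_n E n.

Lemma measurable_tau g A : measurable A -> measurable (tau g @^-1` A).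
Proof. by move=> mA; rewrite -[_ @^-1` _]setTI; exact: mtau. Qed.

Lemma tau_preimageM g h A : tau g @^-1` (tau h @^-1` A) = tau (g * h)%g @^-1` A.
Proof. by apply/funext => w; rewrite /preimage/= tauM. Qed.

Lemma tau_preimage1 A : tau 1%g @^-1` A = A.
Proof. by apply/funext => w; rewrite /preimage/= tau1. Qed.

Lemma continuously_moved0 : continuously_moved set0.
Proof.
split=> //; first by rewrite measure0.
by move=> e e0; apply: filterE => g; rewrite set0D measure0 lte_fin.
Qed.

(** The set (A \ B) \ g(A \ B) lies in the union of A \ gA and gB \ B. *)
Lemma continuously_movedD A B : continuously_moved A -> continuously_moved B ->
  continuously_moved (A `\` B).
Proof.
move=> [mA fA cA] [mB fB cB]; split; first exact: measurableD.
  by apply: le_lt_trans fA; apply: le_measure; rewrite ?mem_set//; exact: measurableD.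
move=> e e0; have e20 : 0 < e / 2 by rewrite divr_gt0.
have := near_invg (cB _ e20); apply: filterS2 (cA _ e20) => g Ag Bg.
have mtA := measurable_tau g mA; have mtB := measurable_tau g mB.
have BE : mu (tau g @^-1` B `\` B) = mu (B `\` tau g^-1%g @^-1` B).
  rewrite -[RHS](mutau g); last by apply: measurableD => //; exact: measurable_tau.
  congr (mu _); rewrite -[RHS]/(_ `\` tau g @^-1` (tau g^-1%g @^-1` B)).
  by rewrite tau_preimageM mulgV tau_preimage1.
rewrite -BE in Bg.
apply: (@le_lt_trans _ _ (mu ((A `\` tau g @^-1` A) `|` (tau g @^-1` B `\` B)))).
  apply: le_measure; rewrite ?mem_set//.
  - by do !apply: measurableD => //; exact: measurable_tau (measurableD _ _).
  - by apply: measurableU; exact: measurableD.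
  - move=> w [[Aw nBw]] /=; have [Ag'|nAg] := pselect (A (tau g w)); last by left.
    by move=> /not_andP[//|/contrapT Bg']; right.
apply: le_lt_trans (measureU2 _ _ _) _; try exact: measurableD.
by rewrite (splitr e) EFinD lteD.
Qed.

Lemma continuously_movedI A B : continuously_moved A -> continuously_moved B ->
  continuously_moved (A `&` B).
Proof. by move=> cA cB; rewrite -setDD; do !apply: continuously_movedD. Qed.

(** As the total measure is finite, a finite subunion carries all but e/2 of the mass, and finite
    unions inherit the property. *)
Lemma continuously_moved_bigcup (E : nat -> set T) :
  (forall n, continuously_moved (E n)) -> (mu (\bigcup_n E n) < +oo)%E ->
  continuously_moved (\bigcup_n E n).
Proof.
move=> cE fE; have mE n : measurable (E n) by have [] := cE n.
have mU : measurable (\bigcup_n E n) by exact: bigcup_measurable.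
split=> // e e0; have e20 : 0 < e / 2 by rewrite divr_gt0.
pose F n := \big[setU/set0]_(i < n) E i.
have mF n : measurable (F n) by apply: bigsetU_measurable.
have FU n : F n `<=` \bigcup_n E n by exact: bigsetU_bigcup.
have cF n : forall a : R, 0 < a -> \forall g \near (1%g : G),
  (mu (F n `\` tau g @^-1` F n) < a%:E)%E.
  elim: n => [|n IH] a a0.
    by apply: filterE => g; rewrite /F big_ord0 set0D measure0 lte_fin.
  have a20 : 0 < a / 2 by rewrite divr_gt0.
  have [_ _ cEn] := cE n; apply: filterS2 (IH _ a20) (cEn _ a20) => g h1 h2.
  have mt A : measurable A -> measurable (tau g @^-1` A) by exact: measurable_tau.
  apply: (@le_lt_trans _ _ (mu ((F n `\` tau g @^-1` F n) `|` (E n `\` tau g @^-1` E n)))).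
    apply: le_measure; rewrite ?mem_set//.
    - by apply: measurableD => //; exact: mt.
    - by apply: measurableU; apply: measurableD => //; exact: mt.
    - rewrite /F big_ord_recr/= -/(F n) => w [[Fw|Ew]] /= /not_orP[n1 n2]; [left|right]; by split.
  apply: le_lt_trans (measureU2 _ _ _) _; try by apply: measurableD => //; exact: mt.
  by rewrite (splitr a) EFinD lteD.
have [n hn] : exists n, (mu ((\bigcup_n E n) `\` F n) < (e / 2)%:E)%E.
  have := @nonincreasing_cvg_mu _ _ _ mu (fun n => (\bigcup_n E n) `\` F n).
  rewrite (_ : \bigcap_n _ = set0); last first.
    apply/seteqP; split=> // w /= h; have [[m _ Em] _] := h 0%N I.
    by have [_] := h m.+1 I; apply; rewrite /F big_ord_recr; right.
  have -> : F 0%N = set0 by rewrite /F big_ord0.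
  rewrite setD0 measure0 => /(_ fE) cvg0.
  have {}cvg0 : (mu \o (fun n => \bigcup_n E n `\` F n)) n @[n --> \oo] --> 0%E.
    apply: cvg0 => [i||i j ij]; [exact: measurableD|by []|].
    by apply/subsetPset; apply: setDS; exact: subset_bigsetU.
  have /cvg0 [N _ hN] : \forall y \near 0%E, (y < (e / 2)%:E)%E.
    by apply: open_nbhs_nbhs; split; [exact: open_ereal_lt_ereal|rewrite /= lte_fin].
  by exists N; apply: hN => /=.
apply: filterS (cF n _ e20) => g hg.
have mt A : measurable A -> measurable (tau g @^-1` A) by exact: measurable_tau.
apply: (@le_lt_trans _ _ (mu (((\bigcup_n E n) `\` F n) `|` (F n `\` tau g @^-1` F n)))).
  apply: le_measure; rewrite ?mem_set//.
  - by apply: measurableD => //; exact: mt.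
  - by apply: measurableU; apply: measurableD => //; exact: mt.
  - move=> w [Ew nE]; have [Fw|nF] := pselect (F n w); [right|by left].
    by split=> // /FU.
apply: le_lt_trans (measureU2 _ _ _) _; try by apply: measurableD => //; exact: mt.
by rewrite (splitr e) EFinD lteD.
Qed.

(** By invariance mu(hA \ ghA) = mu(A \ h^-1 g h A), and conjugation by h is continuous at 1. *)
Lemma continuously_moved_tau h A : continuously_moved A -> continuously_moved (tau h @^-1` A).
Proof.
move=> [mA fA cA]; split; [exact: measurable_tau|by rewrite mutau|move=> e e0].
apply: filterS (near_conjg h (cA _ e0)) => g.
rewrite -(mutau h); last by apply: measurableD => //; exact: measurable_tau.
rewrite -[_ @^-1` _]/(tau h @^-1` A `\` tau h @^-1` (_ @^-1` A)).
by rewrite !tau_preimageM !mulgA mulgV mul1g.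
Qed.

Lemma continuously_moved_local : continuously_moved `<=` locally_continuously_moved.
Proof. by move=> A cA E cE; exact: continuously_movedI. Qed.

Lemma sigma_algebra_local : sigma_algebra setT locally_continuously_moved.
Proof.
split=> [E cE|A lA E cE|A lA E cE]; first by rewrite set0I; exact: continuously_moved0.
  have -> : (setT `\` A) `&` E = E `\` (A `&` E).
    apply/seteqP; split=> w [] /=; first by move=> [_ nA] Ew; split=> // -[].
    by move=> Ew nAE; split=> //; split=> // Aw; exact: nAE.
  exact: continuously_movedD (lA _ cE).
rewrite setI_bigcupl; apply: continuously_moved_bigcup => [n|]; first exact: lA.
have [mE fE _] := cE; apply: le_lt_trans fE; apply: le_measure; rewrite ?mem_set//.
  by apply: bigcup_measurable => n _; have [] := lA n _ cE.
by apply: bigcup_sub => n _ w [].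
Qed.

Lemma sigma_continuously_moved_sub A B : locally_continuously_moved A ->
  A `<=` B -> sigma_continuously_moved B -> sigma_continuously_moved A.
Proof.
move=> lA AB [E cE EB]; exists (fun n => A `&` E n); first by move=> n; exact: lA.
by rewrite -setI_bigcupr -EB; apply/esym/setIidPl.
Qed.

Lemma sigma_continuously_moved_bigcup (A : nat -> set T) :
  (forall n, sigma_continuously_moved (A n)) -> sigma_continuously_moved (\bigcup_n A n).
Proof.
move=> sA; have /choice[E hE] : forall n, exists E : nat -> set T,
    (forall k, continuously_moved (E k)) /\ A n = \bigcup_k E k.
  by move=> n; have [E cE AE] := sA n; exists E.
(* An enumeration of the pairs; numbers that decode to no pair repeat (0, 0), which leaves the union
   unchanged. *)
pose f (n : nat) := odflt (0%N, 0%N) (choice.unpickle n : option (nat * nat)).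
exists (fun n => E (f n).1 (f n).2); first by move=> n; have [] := hE (f n).1.
apply/seteqP; split=> [w [n _]|w [n _ Ew]].
  have [_ ->] := hE n => -[k _ Ew]; exists (choice.pickle (n, k)) => //.
  by rewrite /f choice.pickleK.
by exists (f n).1 => //; have [_ ->] := hE (f n).1; exists (f n).2.
Qed.

Lemma sigma_continuously_moved_measurable A : sigma_continuously_moved A -> measurable A.
Proof. by move=> [E cE ->]; apply: bigcup_measurable => n _; have [] := cE n. Qed.

(* Giving infinite mass to the sets that are not sigma-finite for the continuously moved sets
   ensures that every set of finite mass is continuously moved. *)
Definition continuous_part : set T -> \bar R :=
  fun A => if `[< sigma_continuously_moved A >] then mu A else +oo%E.

Lemma continuous_partE A : sigma_continuously_moved A -> continuous_part A = mu A.
Proof. by move=> sA; rewrite /continuous_part asboolT. Qed.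

Lemma continuously_moved_sigma A : continuously_moved A -> sigma_continuously_moved A.
Proof. by move=> cA; exists (fun=> A) => //; rewrite bigcup_const//; exists 0%N. Qed.

Lemma continuous_part_lty A : (continuous_part A < +oo)%E -> continuously_moved A.
Proof.
rewrite /continuous_part; case: asboolP => [|_]; last by rewrite ltxx.
by move=> [E cE ->]; exact: continuously_moved_bigcup.
Qed.

Lemma continuous_part0 : continuous_part set0 = 0%E.
Proof.
by rewrite continuous_partE ?measure0//; exact: continuously_moved_sigma continuously_moved0.
Qed.

Lemma continuous_part_ge0 A : (0 <= continuous_part A)%E.
Proof. by rewrite /continuous_part; case: asboolP => _; rewrite ?leey. Qed.

(** If one piece is not sigma-continuously moved, neither is the union, since the property passes to
    local subsets; both sides are then +oo. *)
Lemma continuous_part_sigma_additive (F : nat -> set T) :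
  (forall n, locally_continuously_moved (F n)) -> trivIset setT F ->
  (fun n => \sum_(0 <= i < n) continuous_part (F i))%E @ \oo -->
    continuous_part (\bigcup_n F n).
Proof.
move=> lF tF; have [sF|] := pselect (forall n, sigma_continuously_moved (F n)).
  rewrite continuous_partE; last exact: sigma_continuously_moved_bigcup.
  under eq_fun do under eq_bigr do rewrite continuous_partE//.
  apply: measure_semi_sigma_additive => //.
    by move=> n; exact: sigma_continuously_moved_measurable.
  by apply: bigcup_measurable => n _; exact: sigma_continuously_moved_measurable.
move=> /existsNP[n nsF].
rewrite [continuous_part (\bigcup_n F n)]/continuous_part asboolF; last first.
  move=> sU; apply: nsF; apply: sigma_continuously_moved_sub sU => //.
  exact: bigcup_sup.
apply: cvg_near_cst; exists n.+1 => // m /= nm.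
rewrite big_mkord (bigD1 (Ordinal nm))//= {1}/continuous_part asboolF//.
by rewrite addye// gt_eqF// (lt_le_trans ltNy0)// sume_ge0// => i _; exact: continuous_part_ge0.
Qed.

Local Notation LT := (g_sigma_algebraType locally_continuously_moved).

Lemma measurable_localE : @measurable _ LT = locally_continuously_moved.
Proof. exact: sigma_algebra_id sigma_algebra_local. Qed.

Let continuous_part_semi_sigma_additive :
  semi_sigma_additive (continuous_part : set LT -> \bar R).
Proof.
move=> F mF tF _; apply: continuous_part_sigma_additive => // n.
by rewrite -measurable_localE.
Qed.

HB.instance Definition _ := isMeasure.Build _ LT R (continuous_part : set LT -> \bar R)
  continuous_part0 continuous_part_ge0 continuous_part_semi_sigma_additive.

Definition continuous_part_measure : {measure set LT -> \bar R} := continuous_part.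

Lemma measurable_tau_local g : measurable_fun setT (tau g : LT -> LT).
Proof.
move=> _ A; rewrite setTI measurable_localE => lA E cE.
have -> : tau g @^-1` A `&` E = tau g @^-1` (A `&` tau g^-1%g @^-1` E).
  rewrite -[RHS]/(_ `&` tau g @^-1` (_ @^-1` E)).
  by rewrite tau_preimageM mulgV tau_preimage1.
by apply: continuously_moved_tau; apply: lA; exact: continuously_moved_tau.
Qed.

Lemma continuous_part_tau g A : @measurable _ LT A ->
  continuous_part (tau g @^-1` A) = continuous_part A.
Proof.
have sig h B : sigma_continuously_moved B -> sigma_continuously_moved (tau h @^-1` B).
  move=> [E cE ->]; exists (fun n => tau h @^-1` E n); last exact: preimage_bigcup.
  by move=> n; exact: continuously_moved_tau.
move=> _; rewrite /continuous_part; case: asboolP => [sA|nsA].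
  have := sig g^-1%g _ sA; rewrite tau_preimageM mulVg tau_preimage1 => sA'.
  by rewrite asboolT// mutau//; exact: sigma_continuously_moved_measurable.
by rewrite asboolF// => /(sig g) sA; apply: nsA.
Qed.

End ContinuousPart.

(** * Density of indicators in L^p *)

Import HBNNSimple.

Section LpDensity.
Context {R : realType} {d : measure_display} {T : measurableType d}.
Context (nu : {measure set T -> \bar R}) (p : R) (p1 : (1 <= p%:E)%E).
Implicit Types f g : T -> R.
Local Notation inLp f := (f \in Lfun nu p%:E).
Local Notation Lp_norm := (Lp_norm nu p).

Let p1' : 1 <= p. Proof. by rewrite -lee_fin. Qed.
Let p0 : 0 < p. Proof. exact: lt_le_trans p1'. Qed.

Lemma measurable_normr_powR f : measurable_fun setT f ->
  measurable_fun setT (fun x => (`|f x| `^ p)%:E).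
Proof.
move=> mf; apply/measurable_EFinP.
apply: (@measurableT_comp _ _ _ _ _ _ (fun a : R => a `^ p)) => //.
exact: measurableT_comp.
Qed.

Lemma integral_inLp f : measurable_fun setT f ->
  (\int[nu]_x (`|f x| `^ p)%:E < +oo)%E -> inLp f.
Proof.
move=> mf fi; apply/inLpP; split=> //.
rewrite ltey; apply/negP => /eqP fy; move: fi.
have := @poweR_Lnorm _ _ _ nu (EFin \o f) p; rewrite gt_eqF// fy => /(_ isT) h.
rewrite poweRyr ?gt_eqF// in h; by rewrite -[X in (X < _)%E]/(\int[nu]_x `|(EFin \o f) x| `^ p)%E
  -h ltxx.
Qed.

Lemma inLp_measurable f : inLp f -> measurable_fun setT f.
Proof. by move=> /inLpP[]. Qed.

Lemma inLp_integral f : inLp f -> (\int[nu]_x (`|f x| `^ p)%:E < +oo)%E.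
Proof.
move=> /(Lp_integrable p1)/integrable_fin_num => /(_ measurableT) K.
by rewrite ltey_eq K.
Qed.

Lemma inLp_normr_le f g : measurable_fun setT f -> (forall x, `|f x| <= `|g x|) ->
  inLp g -> inLp f.
Proof.
move=> mf fg lg; apply: integral_inLp => //; apply: le_lt_trans (inLp_integral lg).
apply: ge0_le_integral => //.
- exact: measurable_normr_powR.
- exact: measurable_normr_powR (inLp_measurable lg).
- by move=> x _; rewrite lee_fin; apply: ge0_ler_powR; rewrite ?nnegrE ?(ltW p0).
Qed.

Lemma powR_le_inj (a b : R) : 0 <= a -> 0 <= b -> a `^ p <= b `^ p -> a <= b.
Proof.
move=> a0 b0; rewrite leNgt => /negP ab; rewrite leNgt; apply/negP => ba; apply: ab.
by apply: gt0_ltr_powR; rewrite ?nnegrE.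
Qed.

Lemma ae_eq_Lp_norm f g : measurable_fun setT f -> measurable_fun setT g ->
  {ae nu, forall x, f x = g x} -> Lp_norm f = Lp_norm g.
Proof.
move=> mf mg fg.
have : Lp_norm f `^ p = Lp_norm g `^ p.
  rewrite !(Lp_norm_powR _ p1); congr fine.
  apply: (ae_eq_integral _ _ measurableT (measurable_normr_powR mf) (measurable_normr_powR mg)).
  by apply: filterS fg => x fgx _; rewrite fgx.
by move=> h; apply/le_anti/andP; split; apply: powR_le_inj (Lp_norm_ge0 _ _ _) (Lp_norm_ge0 _ _
  _) _; rewrite h.
Qed.

Lemma Lp_norm_le f g : inLp g -> measurable_fun setT f -> (forall x, `|f x| <= `|g x|) ->
  Lp_norm f <= Lp_norm g.
Proof.
move=> lg mf fg; have lf := inLp_normr_le mf fg lg.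
apply: powR_le_inj; rewrite ?Lp_norm_ge0// !(Lp_norm_powR _ p1).
apply: fine_le; rewrite ?ge0_fin_numE ?inLp_integral//.
- by apply: integral_ge0 => x _; rewrite lee_fin powR_ge0.
- by apply: integral_ge0 => x _; rewrite lee_fin powR_ge0.
apply: ge0_le_integral => //.
- exact: measurable_normr_powR.
- exact: measurable_normr_powR (inLp_measurable lg).
- by move=> x _; rewrite lee_fin; apply: ge0_ler_powR; rewrite ?nnegrE ?(ltW p0).
Qed.

Lemma normr_indic_powR (A : set T) x : `|\1_A x : R| `^ p = \1_A x.
Proof. by rewrite indicE; case: (_ \in _); rewrite /= ?normr1 ?powR1// normr0 powR0// gt_eqF. Qed.

Lemma inLp_indic A : measurable A -> (nu A < +oo)%E -> inLp (\1_A : T -> R).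
Proof.
move=> mA fA; apply: integral_inLp; first exact: measurable_indic.
by under eq_integral do rewrite normr_indic_powR; rewrite integral_indic// setIT.
Qed.

Lemma Lp_norm_indic A : measurable A -> Lp_norm (\1_A) `^ p = fine (nu A).
Proof.
move=> mA; rewrite Lp_norm_powR//; congr fine.
by under eq_integral do rewrite normr_indic_powR; rewrite integral_indic// setIT.
Qed.

Lemma LspaceType_eq (u v : LspaceType nu p1) :
  {ae nu, forall x, (u x : R) = v x} -> u = v.
Proof.
case: u v => [u [[uf]]] [v [[vf]]] /= uv.
have E : u = v.
  rewrite -[u]reprK -[v]reprK; apply/eqmodP/asboolP.
  by apply: filterS uv => x h _.
by subst v; rewrite (bool_irrelevance uf vf).
Qed.

Local Open Scope quotient_scope.

Lemma Lp_class f : inLp f ->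
  exists u : LspaceType nu p1, {ae nu, forall x, (u x : R) = f x}.
Proof.
move=> lf; have [mf _] := (inLpP nu p f).1 lf.
pose h : {mfun T >-> measurableTypeR R} := HB.pack_for {mfun T >-> measurableTypeR R} f
  (isMeasurableFun.Build _ _ T (measurableTypeR R) f mf).
pose u : @aeEqMfun _ _ R T (measurableTypeR R) nu := \pi_(@aeEqMfun _ _ R T (measurableTypeR R)
  nu) h.
have uf : {ae nu, forall x, (u x : R) = f x}.
  have : ae_eq_op nu (repr u) h by apply/eqmodP; rewrite reprK.
  by move=> /asboolP; apply: filterS => x; apply.
have finu : finite_norm nu p%:E (u : T -> R).
  have mu' := @measurable_funPT _ _ _ _ (repr u); suff /inLpP[] : inLp (u : T -> R) by [].
  apply: integral_inLp => //; apply: le_lt_trans (inLp_integral lf).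
  rewrite le_eqVlt; apply/orP; left; apply/eqP.
  apply: (ae_eq_integral _ _ measurableT (measurable_normr_powR mu') (measurable_normr_powR mf)).
  by apply: filterS uf => x ufx _; rewrite -ufx.
by exists (LebesgueSpace.Pack (LebesgueSpace.Class (@isFinLebesgue.Axioms_ _ _ _ _ _ p1 _ finu))).
Qed.
Lemma Lp_norm_lt f (e : R) : inLp f -> 0 < e ->
  (\int[nu]_x (`|f x| `^ p)%:E < (e `^ p)%:E)%E -> Lp_norm f < e.
Proof.
move=> lf e0 fe; rewrite ltNge; apply/negP => ef; move: fe; rewrite ltNge => /negP; apply.
rewrite -[leRHS]fineK; last by rewrite ge0_fin_numE ?inLp_integral// integral_ge0.
rewrite lee_fin -(Lp_norm_powR _ p1); apply: ge0_ler_powR => //; rewrite ?nnegrE ?(ltW p0)//.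
  exact: ltW.
exact: Lp_norm_ge0.
Qed.

Lemma Lp_norm_indic_lt A (a : R) : measurable A -> 0 < a -> (nu A < (a `^ p)%:E)%E ->
  Lp_norm (\1_A) < a.
Proof.
move=> mA a0 nuA; apply: Lp_norm_lt => //; first by apply: inLp_indic => //;
  rewrite (lt_trans nuA)// ltry.
by under eq_integral do rewrite normr_indic_powR; rewrite integral_indic// setIT.
Qed.

Lemma Lp_normZ_le a f : inLp f -> Lp_norm (fun w => a * f w) <= `|a| * Lp_norm f.
Proof.
move=> lf; apply: powR_le_inj; rewrite ?Lp_norm_ge0 ?mulr_ge0 ?Lp_norm_ge0//.
rewrite powRM ?Lp_norm_ge0// !(Lp_norm_powR _ p1).
under eq_integral do rewrite normrM powRM// EFinM.
have fi := Lp_integrable p1 lf.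
by rewrite (integralZl measurableT fi) fineM// integrable_fin_num.
Qed.

(** An induction principle that reduces strong continuity of a representation to indicators of sets
    of finite measure. *)
Lemma Lp_dense (P : (T -> R) -> Prop) :
    (forall A, measurable A -> (nu A < +oo)%E -> P \1_A) ->
    (forall a f, inLp f -> P f -> P (fun x => a * f x)) ->
    (forall f g, inLp f -> inLp g -> P f -> P g -> P (f \+ g)) ->
    (forall f, inLp f ->
      (forall e : R, 0 < e -> exists g, [/\ inLp g, P g & Lp_norm (f \- g) < e]) -> P f) ->
  forall f, inLp f -> P f.
Proof.
move=> Pindic PZ PD Plim.
have l0 : inLp (\1_set0 : T -> R) by apply: inLp_indic; rewrite ?measure0.
have P0 : P \1_set0 by apply: Pindic; rewrite ?measure0.
have Ppos f : inLp f -> (forall x, 0 <= f x) -> P f.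
  move=> lf f0; apply: Plim => // e e0.
  have mf : measurable_fun setT (EFin \o f).
    by apply/measurable_EFinP; exact: inLp_measurable.
  pose s n : {nnsfun T >-> R} := nnsfun_approx measurableT mf n.
  have cs x : (fun n => s n x) @ \oo --> f x.
    have := @cvg_nnsfun_approx _ _ _ _ measurableT _ mf (fun x _ => f0 x) x I.
    by move=> /fine_cvgP[].
  have sf n x : s n x <= f x.
    have nd : nondecreasing_seq (fun n => s n x).
      by move=> m k mk; have /lefP := nd_nnsfun_approx measurableT mf mk; apply.
    rewrite -(cvg_lim (@Rhausdorff _) (cs x)); apply: nondecreasing_cvgn_le => //.
    by apply/cvg_ex; exists (f x).
  have s0 n x : 0 <= s n x by [].
  have ls n : inLp (s n : T -> R).
    apply: inLp_normr_le lf => // x; by rewrite !ger0_norm.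
  have Ps n : P (s n : T -> R).
    have -> : (s n : T -> R) = fun x =>
        \sum_(y <- fset_set (range (s n))) y * \1_(s n @^-1` [set y]) x.
      by apply/funext => x; rewrite [LHS]fimfunE fsbig_finite.
    have term y : inLp (fun x => y * \1_(s n @^-1` [set y]) x) /\
        P (fun x => y * \1_(s n @^-1` [set y]) x).
      (* The level set of 0 may have infinite measure; its term is the zero function, written as the
         indicator of [set0]. *)
      have [->|y0] := eqVneq y 0.
        by rewrite (_ : (fun x => _) = \1_set0)//; apply/funext => x; rewrite mul0r indic0.
      have my : measurable (s n @^-1` [set y]) by exact: measurable_sfunP.
      have ly : inLp (\1_(s n @^-1` [set y]) : T -> R).
        (* On this level set y = s n x <= f x, so its indicator is at most y^-1 f; this yields its
           finite measure below. *)
        apply: inLp_normr_le (inLpZ p1 y^-1 lf) => // x.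
        rewrite indicE; case: (boolP (x \in _)) => [/set_mem/= yx|_]; last by rewrite normr0.
        have snx0 : 0 < s n x by rewrite lt_neqAle s0 andbT eq_sym yx.
        by rewrite -yx normr1 ger0_norm ?mulr_ge0 ?invr_ge0// ler_pdivlMl// mulr1.
      split; first exact: inLpZ.
      apply: PZ => //; apply: Pindic => //.
      move: (inLp_integral ly); under eq_integral do rewrite normr_indic_powR.
      by rewrite integral_indic// setIT.
    set r := (X in P (fun x => \sum_(y <- X) _)).
    suff [] : inLp (fun x => \sum_(y <- r) y * \1_(s n @^-1` [set y]) x) /\
      P (fun x => \sum_(y <- r) y * \1_(s n @^-1` [set y]) x) by [].
    elim: (r : seq R) => [|y r' [lr IH]].
      by rewrite (_ : (fun x => _) = \1_set0)//; apply/funext => x; rewrite big_nil indic0.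
    have [ty Py] := term y.
    rewrite (_ : (fun x => \sum_(z <- y :: r') _) = (fun x => y * \1_(s n @^-1` [set y]) x) \+
      (fun x => \sum_(y <- r') y * \1_(s n @^-1` [set y]) x)).
      by split; [exact: inLpD|exact: PD].
    by apply/funext => x; rewrite big_cons.
  have [n hn] : exists n, (\int[nu]_x (`|f x - s n x| `^ p)%:E < (e `^ p)%:E)%E.
    have cvg0 : (fun n => \int[nu]_x (`|f x - s n x| `^ p)%:E)%E @ \oo --> 0%E.
      rewrite -[X in _ --> X](@integral0 _ _ _ nu setT).
      apply: (@dominated_cvg _ _ _ nu setT measurableT _ _ (fun x => (`|f x| `^ p)%:E)).
      - move=> n; apply: measurable_normr_powR; apply: measurable_funB => //.
        exact: inLp_measurable.
      - move=> x _; apply/fine_cvgP; split; first exact: nearW.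
        have : (fun t : R => `|t| `^ p) @ 0 --> `|0 : R| `^ p := @continuous_normr_powR R p p0 0.
        rewrite normr0 powR0 ?gt_eqF// => c0.
        apply: (cvg_comp (fun n => f x - s n x) _ _ c0).
        have := cvgB (cvg_cst (f x)) (cs x); rewrite subrr; exact.
      - by [].
      - exact: Lp_integrable.
      - move=> n x _; rewrite /= lee_fin ger0_norm ?powR_ge0//.
        apply: ge0_ler_powR; rewrite ?nnegrE ?(ltW p0)//.
        by rewrite !ger0_norm ?subr_ge0// gerBl.
    have /cvg0 [N _ hN] : \forall y \near 0%E, (y < (e `^ p)%:E)%E.
      by apply: open_nbhs_nbhs; split; [exact: open_ereal_lt_ereal|rewrite /= lte_fin powR_gt0].
    by exists N; apply: hN => /=.
  by exists (s n); split=> //; apply: Lp_norm_lt => //; exact: inLpB.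
move=> f lf; have mf := inLp_measurable lf.
have -> : f = (fun x => Num.max 0 (f x)) \+ (fun x => -1 * Num.max 0 (- f x)).
  apply/funext => x /=; case: (ltrP 0 (f x)) => fx.
    by rewrite max_l ?mulr0 ?addr0// oppr_le0 ltW.
  by rewrite max_r ?oppr_ge0// mulN1r opprK add0r.
have lp : inLp (fun x => Num.max 0 (f x)).
  apply: inLp_normr_le lf => [|x]; first exact: measurable_maxr.
  by case: (lerP 0 (f x)) => fx; rewrite ?normr0.
have ln : inLp (fun x => Num.max 0 (- f x)).
  apply: inLp_normr_le lf => [|x].
    by apply: measurable_maxr => //; exact: measurableT_comp.
  by case: (lerP 0 (- f x)) => fx; rewrite ?normr0 ?normrN.
apply: PD => //; first exact: inLpZ.
  by apply: Ppos => // x; rewrite le_max lexx.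
by apply: PZ => //; apply: Ppos => // x; rewrite le_max lexx.
Qed.

End LpDensity.

(** * Affine actions from cocycles of sets *)

Section AffineKoopman.
Context {R : realType} {G : topologicalGroupType} {d : measure_display}.
Context {T : measurableType d} (nu : {measure set T -> \bar R}).
Context (p : R) (p1 : (1 <= p%:E)%E) (tau : G -> T -> T) (E : G -> set T).
Hypothesis tau1 : forall w, tau 1%g w = w.
Hypothesis tauM : forall g h w, tau (g * h)%g w = tau h (tau g w).
Hypothesis mtau : forall g, measurable_fun setT (tau g).
Hypothesis nutau : forall g A, measurable A -> nu (tau g @^-1` A) = nu A.
Hypothesis tauC : forall A, measurable A -> (nu A < +oo)%E -> forall e : R, 0 < e ->
  \forall g \near (1%g : G), (nu (A `\` tau g @^-1` A) < e%:E)%E.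
Hypothesis mE : forall g, measurable (E g).
Hypothesis finE : forall g, (nu (E g) < +oo)%E.
Hypothesis EM : forall g h w, E (g * h)%g w <->
  (E g w /\ ~ E h (tau g w)) \/ (~ E g w /\ E h (tau g w)).
Hypothesis EC : forall e : R, 0 < e -> \forall g \near (1%g : G), (nu (E g) < e%:E)%E.

Implicit Types f : T -> R.
Local Notation inLp f := (f \in Lfun nu p%:E).
Local Notation Lp_norm := (Lp_norm nu p).

Let p1' : 1 <= p. Proof. by rewrite -lee_fin. Qed.
Let p0 : 0 < p. Proof. exact: lt_le_trans p1'. Qed.

(** A wall has no preferred side: f(w) is attached to the side of w away from the base point x0, and
    1 - f(w) to the other. Translation by g moves x0 to g x0, which exchanges the sides exactly on E
    g. [flip] is the linear part of this exchange. *)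
Definition flip g w : R := 1 - 2 * \1_(E g) w.
Definition koopman g f w := flip g w * f (tau g w).
Definition affine_koopman g f w := koopman g f w + \1_(E g) w.

Lemma normr_flip g w : `|flip g w| = 1.
Proof.
rewrite /flip indicE; case: (_ \in _); rewrite ?mulr1 ?mulr0 ?subr0 ?normr1//.
by rewrite (_ : 1 - 2 = -1) ?normrN1//; lra.
Qed.

Lemma indic_cocycle g h w :
  \1_(E (g * h)%g) w = flip g w * \1_(E h) (tau g w) + \1_(E g) w :> R.
Proof.
have in1 A (v : T) : A v -> \1_A v = 1 :> R by move=> /mem_set; rewrite indicE => ->.
have in0 A (v : T) : ~ A v -> \1_A v = 0 :> R by move=> nA; rewrite indicE memNset.
rewrite /flip; have [a|a] := pselect (E g w); have [b|b] := pselect (E h (tau g w)).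
- rewrite (in0 (E (g * h)%g)) ?(in1 _ _ a) ?(in1 _ _ b); first by lra.
  by move=> /EM[[_ /(_ b)]|[/(_ a)]].
- rewrite (in1 (E (g * h)%g)) ?(in1 _ _ a) ?(in0 _ _ b); first by lra.
  by apply/EM; left.
- rewrite (in1 (E (g * h)%g)) ?(in0 _ _ a) ?(in1 _ _ b); first by lra.
  by apply/EM; right.
- rewrite (in0 (E (g * h)%g)) ?(in0 _ _ a) ?(in0 _ _ b); first by lra.
  by move=> /EM[[/a]|[_ /b]].
Qed.

Lemma flipM g h w : flip (g * h)%g w = flip g w * flip h (tau g w).
Proof. rewrite /flip indic_cocycle /flip; ring. Qed.

Lemma cocycle1 : E 1%g = set0.
Proof.
apply/seteqP; split=> // w E1w; have := E1w; rewrite -[1%g]mul1g => /EM; rewrite tau1.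
by case=> -[].
Qed.

Lemma affine_koopman1 f : affine_koopman 1%g f = f.
Proof.
by apply/funext => w; rewrite /affine_koopman /koopman /flip tau1 cocycle1 indic0 mulr0 subr0
  mul1r addr0.
Qed.

Lemma affine_koopmanM g h f : affine_koopman (g * h)%g f = affine_koopman g (affine_koopman h f).
Proof.
apply/funext => w; rewrite /affine_koopman /koopman flipM indic_cocycle tauM; ring.
Qed.

Lemma measurable_koopman g f : measurable_fun setT f -> measurable_fun setT (koopman g f).
Proof.
move=> mf; apply: measurable_funM; last exact: measurableT_comp.
apply: measurable_funB => //; apply: measurable_funM => //.
Qed.

Lemma integral_tau g (F : T -> \bar R) : measurable_fun setT F -> (forall w, (0 <= F w)%E) ->
  (\int[nu]_w F (tau g w) = \int[nu]_w F w)%E.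
Proof.
move=> mF F0.
have := @ge0_integral_pushforward _ _ _ _ R _ (mtau g) nu setT F measurableT mF (fun w _ => F0 w).
rewrite preimage_setT => <-; apply: eq_measure_integral => A mA _.
exact: nutau.
Qed.

Lemma integral_koopman g f : measurable_fun setT f ->
  (\int[nu]_w (`|koopman g f w| `^ p)%:E = \int[nu]_w (`|f w| `^ p)%:E)%E.
Proof.
move=> mf; under eq_integral do rewrite /koopman normrM normr_flip mul1r.
apply: (@integral_tau g (fun w => (`|f w| `^ p)%:E)) => [|w]; last by rewrite lee_fin powR_ge0.
exact: measurable_normr_powR.
Qed.

Lemma koopman_inLp g f : inLp f -> inLp (koopman g f).
Proof.
move=> lf; have mf := inLp_measurable lf.
apply: integral_inLp => //; first exact: measurable_koopman.
by rewrite integral_koopman// inLp_integral.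
Qed.

Lemma Lp_norm_koopman g f : inLp f -> Lp_norm (koopman g f) = Lp_norm f.
Proof.
move=> lf; have mf := inLp_measurable lf.
have h : Lp_norm (koopman g f) `^ p = Lp_norm f `^ p.
  by rewrite !(Lp_norm_powR _ p1) integral_koopman.
apply/le_anti/andP; split; apply: (powR_le_inj p1);
  by rewrite ?Lp_norm_ge0// h.
Qed.

Lemma affine_koopman_inLp g f : inLp f -> inLp (affine_koopman g f).
Proof. by move=> lf; apply: inLpD => //; [exact: koopman_inLp|exact: inLp_indic]. Qed.

Lemma ae_tau g (P : T -> Prop) : {ae nu, forall w, P w} -> {ae nu, forall w, P (tau g w)}.
Proof.
move=> [N [mN N0 PN]]; exists (tau g @^-1` N); split.
- by rewrite -[_ @^-1` _]setTI; exact: mtau.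
- by rewrite nutau.
- by move=> w /PN.
Qed.

Lemma koopman_continuous f : inLp f -> forall e : R, 0 < e ->
  \forall g \near (1%g : G), Lp_norm (koopman g f \- f) < e.
Proof.
have mtA g A : measurable A -> measurable (tau g @^-1` A).
  by move=> mA; rewrite -[_ @^-1` _]setTI; exact: mtau.
move: f; apply: (Lp_dense p1).
- move=> A mA fA e e0; pose a := e / 4.
  have a0 : 0 < a by rewrite divr_gt0.
  have ap0 : 0 < a `^ p by rewrite powR_gt0.
  have := near_invg (tauC mA fA ap0); apply: filterS3 (tauC mA fA ap0) (EC ap0) => g h1 h2 h3.
  have mgA := mtA g _ mA.
  have D1 : measurable (A `\` tau g @^-1` A) by exact: measurableD.
  have D2 : measurable (tau g @^-1` A `\` A) by exact: measurableD.
  have {}h3 : (nu (tau g @^-1` A `\` A) < (a `^ p)%:E)%E.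
    apply: le_lt_trans h3; rewrite -[leRHS](nutau g); last first.
      by apply: measurableD => //; exact: mtA.
    rewrite (_ : tau g @^-1` (_ `\` _) = tau g @^-1` A `\` A)//.
    by apply/seteqP; split=> w [] /=; rewrite -tauM mulgV tau1.
  have n1 := Lp_norm_indic_lt p1 D1 a0 h1; have n2 := Lp_norm_indic_lt p1 (mE g) a0 h2.
  have n3 := Lp_norm_indic_lt p1 D2 a0 h3.
  have l1 : inLp (\1_(A `\` tau g @^-1` A) : T -> R).
    by apply: inLp_indic => //; rewrite (lt_trans h1)// ltry.
  have l3 : inLp (\1_(tau g @^-1` A `\` A) : T -> R).
    by apply: inLp_indic => //; rewrite (lt_trans h3)// ltry.
  have l2 : inLp (\1_(E g) : T -> R) by exact: inLp_indic.
  (* On E g the sign is reversed, at a cost of at most 2, hence the repeated indicator of E g. Each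
     of the four indicators has norm below [a] = e/4. *)
  pose b := ((\1_(A `\` tau g @^-1` A) : T -> R) \+ \1_(tau g @^-1` A `\` A)) \+
    ((\1_(E g) : T -> R) \+ \1_(E g)).
  have lb : inLp b by do !apply: inLpD.
  apply: (@le_lt_trans _ _ (Lp_norm b)).
    apply: (Lp_norm_le p1) => //.
      apply: measurable_funB; last exact: measurable_indic.
      by apply: measurable_koopman; exact: measurable_indic.
    move=> w; rewrite /koopman /flip /b /= !indicE !in_setD.
    rewrite (_ : (w \in tau g @^-1` A) = (tau g w \in A)); last first.
      by apply/idP/idP => /set_mem ?; apply/mem_set.
    case: (w \in E g); case: (w \in A); case: (tau g w \in A) => /=;
      rewrite ler_norml ger0_norm; lra.
  have t1 : Lp_norm b <= (Lp_norm \1_(A `\` tau g @^-1` A) + Lp_norm \1_(tau g @^-1` A `\` A)) +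
      (Lp_norm \1_(E g) + Lp_norm \1_(E g)).
    apply: le_trans (Lp_norm_triangle p1 _ _) _; try exact: inLpD.
    by apply: lerD; exact: Lp_norm_triangle.
  by rewrite /a in n1 n2 n3; lra.
- move=> c f lf cf e e0; have c0 : 0 < `|c| + 1 by rewrite ltr_wpDl.
  have := cf (e / (`|c| + 1)); rewrite divr_gt0// => /(_ isT); apply: filterS => g hg.
  rewrite (@eq_Lp_norm _ _ _ nu p _ (fun w => c * (koopman g f \- f) w)); last first.
    by move=> w; rewrite /koopman /=; ring.
  apply: le_lt_trans (Lp_normZ_le p1 _ (inLpB p1 (koopman_inLp g lf) lf)) _.
  rewrite ltr_pdivlMr// in hg; apply: le_lt_trans hg.
  by rewrite mulrC ler_wpM2l ?Lp_norm_ge0// lerDl.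
- move=> f h lf lh cf ch e e0; have e20 : 0 < e / 2 by rewrite divr_gt0.
  apply: filterS2 (cf _ e20) (ch _ e20) => g hf hh.
  rewrite (@eq_Lp_norm _ _ _ nu p _ ((koopman g f \- f) \+ (koopman g h \- h))); last first.
    by move=> w; rewrite /koopman /=; ring.
  apply: le_lt_trans (Lp_norm_triangle p1 (inLpB p1 (koopman_inLp g lf) lf)
    (inLpB p1 (koopman_inLp g lh) lh)) _.
  by rewrite (splitr e) ltrD.
- move=> f lf hf e e0; have e30 : 0 < e / 3 by rewrite divr_gt0.
  have [h [lh ch hfh]] := hf _ e30.
  apply: filterS (ch _ e30) => g hg.
  have lkf := koopman_inLp g lf; have lkh := koopman_inLp g lh.
  have t1 := Lp_norm_triangleB p1 lkf lkh lf.
  have t2 := Lp_norm_triangleB p1 lkh lh lf.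
  have n1 : Lp_norm (koopman g f \- koopman g h) = Lp_norm (f \- h).
    rewrite -(Lp_norm_koopman g (inLpB p1 lf lh)); apply: eq_Lp_norm => w.
    by rewrite /koopman /=; ring.
  have n2 : Lp_norm (h \- f) = Lp_norm (f \- h) by exact: Lp_normBC.
  lra.
Qed.

Lemma affine_koopman_continuous f : inLp f -> forall e : R, 0 < e ->
  \forall g \near (1%g : G), Lp_norm (f \- affine_koopman g f) < e.
Proof.
move=> lf e e0; have e20 : 0 < e / 2 by rewrite divr_gt0.
have ep0 : 0 < (e / 2) `^ p by rewrite powR_gt0.
apply: filterS2 (koopman_continuous lf e20) (EC ep0) => g hg hE.
have {}hE := Lp_norm_indic_lt p1 (mE g) e20 hE.
rewrite Lp_normBC (@eq_Lp_norm _ _ _ nu p _ ((koopman g f \- f) \+ \1_(E g))); last first.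
  by move=> w; rewrite /affine_koopman /=; ring.
apply: le_lt_trans (Lp_norm_triangle p1 (inLpB p1 (koopman_inLp g lf) lf)
  (inLp_indic p1 (mE g) (finE g))) _.
by rewrite (splitr e) ltrD.
Qed.

(** The dichotomy is read off the orbit of 0, which g moves to the indicator of E g. The action on
    classes comes from a choice of class for each transformed representative, so its laws are
    checked almost everywhere. *)
Lemma BP_Lp_cocycle : BP_Lp G p1 ->
  (exists M : R, forall g, fine (nu (E g)) <= M) \/
  (fun g => fine (nu (E g))) @ at_infinity G --> +oo.
Proof.
move=> BP; pose Lp := LspaceType nu p1.
have inL (u : Lp) : inLp (u : T -> R) := LspaceType_inLp u.
have mL (u : Lp) : measurable_fun setT (u : T -> R) := inLp_measurable (inL u).
have inA g (u : Lp) : inLp (affine_koopman g u) := affine_koopman_inLp g (inL u).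
have /choice[act0 hact] : forall gu : G * Lp, exists v : Lp,
    {ae nu, forall w, (v w : R) = affine_koopman gu.1 gu.2 w}.
  by move=> [g u]; exact: (Lp_class p1 (inA g u)).
pose act g u := act0 (g, u).
have {}hact g u : {ae nu, forall w, (act g u w : R) = affine_koopman g u w}.
  exact: (hact (g, u)).
have act1 u : act 1%g u = u.
  by apply: LspaceType_eq; apply: filterS (hact 1%g u) => w; rewrite affine_koopman1.
have actM g h u : act (g * h)%g u = act g (act h u).
  apply: LspaceType_eq.
  apply: filterS3 (hact (g * h)%g u) (hact g (act h u)) (ae_tau g (hact h u)) => w h1 h2 h3.
  by rewrite h1 h2 affine_koopmanM /affine_koopman /koopman h3.
have gact : group_action act by [].
have aff g : Lp_affine (act g).
  move=> t u v w huvw.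
  apply: filterS (filterI (filterI (hact g u) (hact g v)) (filterI (hact g w) (ae_tau g huvw))).
  move=> x [[-> ->] [-> h]]; rewrite /affine_koopman /koopman h; ring.
have self (u : Lp) : {ae nu, forall w, (u w : R) = u w} by exact: aeW.
have distE (u v : Lp) (f h : T -> R) : inLp f -> inLp h ->
    {ae nu, forall w, (u w : R) = f w} -> {ae nu, forall w, (v w : R) = h w} ->
    Lp_dist u v = Lp_norm (f \- h).
  move=> lf lh uf vh; rewrite Lp_distE; apply: (ae_eq_Lp_norm p1).
  - by apply: measurable_funB; exact: mL.
  - exact: measurable_funB (inLp_measurable lf) (inLp_measurable lh).
  - by apply: filterS2 uf vh => w /= -> ->.
have iso : isometric_action (@Lp_dist _ _ _ nu p p1) act.
  move=> g u v; rewrite (distE _ _ _ _ (inA g u) (inA g v) (hact g u) (hact g v)).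
  rewrite Lp_distE -(Lp_norm_koopman g (inLpB p1 (inL u) (inL v))).
  by apply: eq_Lp_norm => w; rewrite /affine_koopman /koopman /=; ring.
have cont : continuous_action (@Lp_dist _ _ _ nu p p1) act.
  move=> g u e e0; have e20 : 0 < e / 2 by rewrite divr_gt0.
  exists (e / 2) => //.
  apply: filterS (near_mulgl g (affine_koopman_continuous (inL u) e20)) => h hh v uv.
  apply: le_lt_trans (Lp_dist_triangle (act h u) _ _) _.
  rewrite iso (splitr e) ltrD// -(mulVKg g h) actM iso.
  by rewrite (distE _ _ _ _ (inL u) (inA _ u) (self u) (hact _ u)).
have lz : inLp (\1_set0 : T -> R) by apply: (inLp_indic p1); rewrite ?measure0.
have [u0 hu0] := Lp_class p1 lz.
have distg g : Lp_dist (act g u0) u0 `^ p = fine (nu (E g)).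
  rewrite -(Lp_norm_indic nu p1 (mE g)); congr (_ `^ p).
  rewrite (distE _ _ _ _ (inA g u0) (inL u0) (hact g u0) (self u0)).
  apply: (ae_eq_Lp_norm p1).
  - exact: measurable_funB (inLp_measurable (inA g u0)) (mL u0).
  - exact: measurable_indic.
  - apply: filterS2 hu0 (ae_tau g hu0) => w h1 h2.
    by rewrite /affine_koopman /koopman /= h1 h2 !indic0 mulr0 add0r subr0.
have [bd|pr] := BP _ _ _ _ gact aff iso cont.
  left; have [M hM] := bd u0; exists (M `^ p) => g.
  rewrite -distg; have := hM g 1%g; rewrite act1 => hg.
  by apply: ge0_ler_powR; rewrite ?nnegrE ?(ltW p0) ?Lp_dist_ge0// (le_trans _ hg)// Lp_dist_ge0.
(* The lower bound 1 gives c <= c^p. *)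
right; apply/cvgryPge => A; pose c := Num.max 1 A.
have c1 : 1 <= c by rewrite le_max lexx.
have /cvgryPge/(_ c) := pr u0; apply: filterS => g cg.
rewrite -distg; apply: (@le_trans _ _ c); first by rewrite le_max lexx orbT.
apply: (@le_trans _ _ (c `^ p)); first by rewrite -[leLHS]powRr1 ?ler_powR// (le_trans ler01).
by apply: ge0_ler_powR; rewrite ?nnegrE ?(ltW p0) ?Lp_dist_ge0// (le_trans ler01).
Qed.

End AffineKoopman.

(** * Action on the walls *)

Lemma separates_wall_map (X : Type) (s s' : X -> X) w x y :
  cancel s s' -> cancel s' s -> separates (wall_map s w) (s x) (s y) <-> separates w x y.
Proof.
move=> sK s'K; split=> [[_ [A wA <-] [[a Aa /(can_inj sK) ax] nAy]]|[A wA [Ax nAy]]].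
  by exists A => //; rewrite -ax; split=> // Ay; apply: nAy; exists y.
exists (s @` A); first by exists A.
by split; [exists x|move=> [b Ab /(can_inj sK) by_]; apply: nAy; rewrite -by_].
Qed.

(** A wall has two sides, so separation adds modulo 2; this is the cocycle identity for the sets
    W(x0|g x0). *)
Lemma separates_xor (X : Type) (w : set (set X)) x y z : is_wall w ->
  separates w x z <-> (separates w x y /\ ~ separates w y z) \/
                      (~ separates w x y /\ separates w y z).
Proof.
move=> [A [_ _ wE]].
have sepE a b : separates w a b <-> (A a /\ ~ A b) \/ (~ A a /\ A b).
  rewrite wE; split=> [[B [->|->] [Ba Bb]]|[[Aa Ab]|[Aa Ab]]]; [by left| |by exists A; [left|]|].
    by right; split=> //; exact: contrapT.
  by exists (~` A); [right|split=> // /(_ Ab)].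
have [Ax|Ax] := pselect (A x); have [Ay|Ay] := pselect (A y); have [Az|Az] := pselect (A z);
  rewrite !sepE; tauto.
Qed.

Section WallCocycle.
Context {R : realType} {G : topologicalGroupType} {X : Type} (S : measured_walls R X).
Context (act : G -> X -> X).
Hypothesis gact : group_action act.
Hypothesis aut : forall g, wall_automorphism S (act g).
Hypothesis cont : continuous_action (wall_dist S) act.

Local Notation W := (walls S).
Local Notation D := (walls_between (walls S)).
Local Notation WT := (g_sigma_algebraType (wall_algebra S)).
Local Notation mu := (wall_measure S).

(** The inverse makes this a right action whose preimages are the translates of sets of walls. *)
Definition pull_walls g : WT -> WT := wall_map (act g^-1%g).

Let actK g : cancel (act g) (act g^-1%g).
Proof. by move=> x; rewrite -gact.2 mulVg gact.1. Qed.

Let actVK g : cancel (act g^-1%g) (act g).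
Proof. by move=> x; rewrite -gact.2 mulgV gact.1. Qed.

Lemma pull_walls1 w : pull_walls 1%g w = w.
Proof.
rewrite /pull_walls invg1 (_ : act 1%g = id) ?wall_map_id//.
by apply/funext => x; rewrite gact.1.
Qed.

Lemma pull_wallsM g h w : pull_walls (g * h)%g w = pull_walls h (pull_walls g w).
Proof.
rewrite /pull_walls -wall_map_comp; congr wall_map.
by apply/funext => x; rewrite invgM gact.2.
Qed.

Lemma pull_walls_preimage g A : pull_walls g @^-1` A = wall_map (act g) @` A.
Proof. by apply/esym/image_can_preimage; apply: wall_map_can. Qed.

Lemma pull_walls_walls g w : W (pull_walls g w) <-> W w.
Proof. by have [_ + _ _] := aut g^-1%g; apply. Qed.

Lemma pull_walls_between g x y : pull_walls g @^-1` D x y = D (act g x) (act g y).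
Proof.
apply/seteqP; split=> w [] /=.
  move=> /pull_walls_walls Ww sep; split=> //.
  by rewrite -(separates_wall_map w _ _ (actVK g) (actK g)) !actK.
move=> Ww sep; split; first exact/pull_walls_walls.
by rewrite -(actK g x) -(actK g y) separates_wall_map.
Qed.

Lemma wall_algebra_walls : wall_algebra S W.
Proof.
have [B0 BD _] := wall_algebra_sigma S.
by rewrite -(setD0 W); exact: BD.
Qed.

Lemma wall_algebra_setI (A : set WT) : measurable A -> wall_algebra S (A `&` W).
Proof.
have [B0 BD BU] := wall_algebra_sigma S.
apply: (@smallest_sub _ _ _ [set A | wall_algebra S (A `&` W)]) => [|A' BA']; last first.
  by rewrite /= (setIidl (wall_algebra_sub BA')).
split=> /= [|B BB|F BF]; first by rewrite set0I.
  rewrite (_ : _ `&` W = W `\` (B `&` W)); first exact: BD.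
  apply/seteqP; split=> w [] /=; first by move=> [_ nB] Ww; split=> // -[].
  by move=> Ww nB; split=> //; split=> // Bw; exact: nB.
by rewrite setI_bigcupl; exact: BU.
Qed.

Lemma wall_measure_setI (A : set WT) : measurable A -> mu A = mu (A `&` W).
Proof.
move=> mA; have mW : measurable (W : set WT) by apply: sub_sigma_algebra; exact: wall_algebra_walls.
have mAW : measurable (A `&` W) by exact: measurableI.
have mCW : measurable (~` W : set WT) by exact: measurableC.
apply/le_anti/andP; split; last by apply: le_measure; rewrite ?mem_set.
rewrite -[leRHS]adde0 -(wall_measure_setC S); apply: le_trans (measureU2 _ mAW mCW).
apply: le_measure; rewrite ?mem_set//; first exact: measurableU.
by move=> w Aw; have [Ww|nW] := pselect (W w); [left|right].
Qed.

Lemma measurable_pull_walls g : measurable_fun setT (pull_walls g).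
Proof.
apply: (@measurability _ _ WT WT setT (pull_walls g) (wall_algebra S)) => // _ [A BA <-];
  rewrite setTI pull_walls_preimage.
by apply: sub_sigma_algebra; have [_ _ h _] := aut g; exact/h.
Qed.

(** An automorphism preserves the measure on [wall_algebra] only; other measurable sets are first
    cut down to the walls, off which the measure vanishes. *)
Lemma wall_measure_pull g A : measurable A -> mu (pull_walls g @^-1` A) = mu A.
Proof.
move=> mA; have mgA : measurable (pull_walls g @^-1` A).
  by rewrite -[_ @^-1` _]setTI; exact: measurable_pull_walls.
rewrite wall_measure_setI// [RHS]wall_measure_setI//.
have [_ _ _ /(_ _ (wall_algebra_setI mA)) <-] := aut g; rewrite -pull_walls_preimage.
by congr (mu _); apply/seteqP; split=> w [Aw] /pull_walls_walls.
Qed.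

Lemma near_wall_dist x (e : R) : 0 < e -> \forall g \near (1%g : G), wall_dist S x (act g x) < e.
Proof.
move=> e0; have [r r0] := cont 1%g x e0; apply: filterS => h /(_ x).
rewrite gact.1; apply; rewrite /wall_dist (_ : D x x = set0) ?measure0//.
by apply/seteqP; split=> // w [_ [A _ []]].
Qed.

(** A wall that separates x from y but not gx from gy separates x from gx or y from gy, and both
    distances are small for g near 1. *)
Lemma continuously_moved_between x y : continuously_moved mu pull_walls (D x y).
Proof.
have mD a b : measurable (D a b : set WT) by exact: measurable_walls_between.
split; [exact: mD|exact: walls_between_fin|move=> e e0].
have e20 : 0 < e / 2 by rewrite divr_gt0.
apply: filterS2 (near_wall_dist x e20) (near_wall_dist y e20) => g hx hy.
rewrite pull_walls_between.
apply: (@le_lt_trans _ _ (mu (D x (act g x) `|` D y (act g y)))).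
  apply: le_measure; rewrite ?mem_set//.
  - by apply: measurableD; exact: mD.
  - by apply: measurableU; exact: mD.
  - move=> w [/(@walls_between_sub _ _ S _ (act g x) _ _) [Dx|Dgx] nD]; first by left.
    have [//|Dy] := @walls_between_sub _ _ S _ (act g y) _ _ Dgx.
    by right; rewrite walls_betweenC.
apply: le_lt_trans (measureU2 _ _ _) _; try exact: mD.
rewrite (_ : (_ + _)%E = (wall_dist S x (act g x) + wall_dist S y (act g y))%:E).
  by rewrite lte_fin (splitr e) ltrD.
by rewrite EFinD !wall_dist_fineK.
Qed.

(** The continuous part of the measure supplies [tauC], since its sets of finite mass are
    continuously moved, and it leaves the mass of W(x|gx) unchanged. *)
Lemma orbit_bounded_or_proper (p : R) (p1 : (1 <= p%:E)%E) x : BP_Lp G p1 ->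
  (exists M : R, forall g, wall_dist S x (act g x) <= M) \/
  (fun g => wall_dist S x (act g x)) @ at_infinity G --> +oo.
Proof.
pose nu := continuous_part_measure pull_walls1 pull_wallsM measurable_pull_walls wall_measure_pull.
pose E g := D x (act g x).
have sE y z : sigma_continuously_moved mu pull_walls (D y z).
  by apply: continuously_moved_sigma; exact: continuously_moved_between.
have nuE g : nu (E g) = mu (E g) by exact: (continuous_partE (sE x (act g x))).
pose LT := g_sigma_algebraType (locally_continuously_moved mu pull_walls).
have nutau g A : @measurable _ LT A -> nu (pull_walls g @^-1` A) = nu A.
  exact: (continuous_part_tau pull_walls1 pull_wallsM measurable_pull_walls wall_measure_pull).
have mtau g := measurable_tau_local pull_walls1 pull_wallsM measurable_pull_walls
  wall_measure_pull g.
have tauC A : @measurable _ LT A -> (nu A < +oo)%E -> forall e : R, 0 < e ->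
    \forall g \near (1%g : G), (nu (A `\` pull_walls g @^-1` A) < e%:E)%E.
  move=> _ fA e e0; have cA := continuous_part_lty measurable_pull_walls fA.
  have [mA _ /(_ e e0)] := cA; apply: filterS => g.
  have sA : sigma_continuously_moved mu pull_walls (A `\` pull_walls g @^-1` A).
    apply: continuously_moved_sigma.
    apply: (continuously_movedD pull_walls1 pull_wallsM measurable_pull_walls wall_measure_pull)
      => //.
    exact: (continuously_moved_tau pull_wallsM measurable_pull_walls wall_measure_pull).
  by have -> : nu (A `\` pull_walls g @^-1` A) = mu (A `\` pull_walls g @^-1` A)
    by exact: (continuous_partE sA).
have mE g : @measurable _ LT (E g).
  apply: sub_sigma_algebra.
  apply: (continuously_moved_local pull_walls1 pull_wallsM measurable_pull_walls wall_measure_pull).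
  exact: continuously_moved_between.
have finE g : (nu (E g) < +oo)%E by rewrite nuE walls_between_fin.
have EC (e : R) : 0 < e -> \forall g \near (1%g : G), (nu (E g) < e%:E)%E.
  move=> e0; apply: filterS (near_wall_dist x e0) => g; rewrite nuE.
  by rewrite -wall_dist_fineK lte_fin.
have EM g h w : E (g * h)%g w <->
    (E g w /\ ~ E h (pull_walls g w)) \/ (~ E g w /\ E h (pull_walls g w)).
  have -> : E h (pull_walls g w) = D (act g x) (act (g * h)%g x) w.
    by rewrite gact.2 -pull_walls_between.
  rewrite /E; have [Ww|nW] := pselect (W w).
    have := separates_xor x (act g x) (act (g * h)%g x) (walls_are_walls Ww).
    by rewrite /walls_between/=; tauto.
  by rewrite /walls_between/=; tauto.
have distE : (fun g => wall_dist S x (act g x)) = (fun g => fine (nu (E g))).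
  by apply/funext => g; rewrite nuE.
move=> /(@BP_Lp_cocycle R G _ _ nu p p1 pull_walls E pull_walls1 pull_wallsM mtau nutau tauC mE
  finE EM EC).
by case=> [[M hM]|pr]; [left; exists M => g; have := hM g; rewrite nuE|right; rewrite distE].
Qed.
End WallCocycle.

Lemma BP_Lp_walls_bounded_or_proper (R : realType) (G : topologicalGroupType)
    (p : R) (p1 : (1 <= p%:E)%E) :
  BP_Lp G p1 -> walls_bounded_or_proper R G.
Proof.
move=> BP X S act gact aut cont.
have [[x0 _]|noX] := pselect (exists x : X, True); last first.
  by left=> x; exfalso; apply: noX; exists x.
have wall_distC x y : wall_dist S x y = wall_dist S y x by rewrite /wall_dist walls_betweenC.
have iso g := wall_automorphism_dist (aut g).
have tri := wall_dist_triangle S.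
(* By isometry and the triangle inequality, replacing x0 by x changes the displacement by g by at
   most 2 d(x, x0), so one orbit decides for all. *)
have [[M hM]|pr] := orbit_bounded_or_proper gact aut cont x0 BP; [left|right] => x.
  exists (2 * wall_dist S x x0 + 2 * M) => g h.
  have h1 := tri (act g x) (act g x0) (act h x); have h2 := tri (act g x0) x0 (act h x).
  have h3 := tri x0 (act h x0) (act h x); rewrite !iso in h1 h3.
  have := hM g; have := hM h; rewrite (wall_distC x0 (act g x0)) (wall_distC x0 x) in h1 h3 *.
  lra.
apply/cvgryPge => A; have /cvgryPge/(_ (A + 2 * wall_dist S x x0)) := pr.
apply: filterS => g hg.
have h1 := tri x0 x (act g x0); have h2 := tri x (act g x) (act g x0).
rewrite iso (wall_distC x (act g x)) in h2; rewrite (wall_distC x0 x) in h1; lra.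
Qed.

Theorem proposition2p8 (R : realType) (G : topologicalGroupType)
    (p : R) (p1 : (1 <= p%:E)%E) :
  hausdorff_space G -> locally_compact [set: G] ->
  (BP_Lp G p1 -> walls_bounded_or_proper R G) /\
  (p <= 2 -> separable_space G ->
    walls_bounded_or_proper R G -> BP_Lp G p1).
Proof.
move=> _ _; split; first exact: BP_Lp_walls_bounded_or_proper.
by move=> p2 _; exact: walls_bounded_or_proper_BP_Lp.
Qed.
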